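(* Let $(G,\nu)$ be a computably enumerable group. The following conditions are equivalent: (i) $G$ is amenable; (ii) $(G,\nu)$ has computable Reiter functions; (iii) $(G,\nu)$ has subrecursive F\o lner function; (iv) $(G,\nu)$ is $\Sigma$-amenable. Moreover, if $(G,\nu)$ is computably amenable, then $(G,\nu)$ is computable.
   Context: All groups are countable; no finite generation is assumed. $X\subset\subset Y$ means that $X$ is a finite subset of $Y$. Finite subsets of $\mathbb{N}$ are identified with their G\''odel numbers (canonical indices), so algorithms can take them as inputs and outputs; finitely supported functions $\mathbb{N}\to\mathbb{Q}_{+}$ are likewise coded as finite objects. Here $\mathbb{Q}_+$ and $\mathbb{R}_+$ denote non-negative numbers, and $n$ ranges over positive integers. A numbered group is a pair $(G,\nu)$ with $G$ a group and $\nu:\mathbb{N}\to G$ a surjection. Put $\mathsf{MultT}=\{(i,j,k)\in\mathbb{N}^3:\nu(i)\nu(j)=\nu(k)\}$. $(G,\nu)$ is computably enumerable if $\mathsf{MultT}$ is computably enumerable, and computable if $\mathsf{MultT}$ is computable (decidable). For $D\subset\subset G$ and $n$, a non-empty set $F\subset\subset G$ is an $n$-F\o lner set with respect to $D$ if $\frac{|F\setminus xF|}{|F|}\le\frac1n$ for all $x\in D$; the set of these is denoted $\mathfrak{F}ol_{G,D}(n)$. $G$ is amenable if $\mathfrak{F}ol_{G,D}(n)\neq\emptyset$ for all $n$ and all $D\subset\subset G$. The F\o lner function of $G$ is $Fol_G(n,D)=\min\{|F|:F\in\mathfrak{F}ol_{G,D}(n)\}$ ($=\infty$ if there is no such $F$).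 A function is subrecursive if it admits a computable total upper bound; $(G,\nu)$ has subrecursive F\o lner function if there is a total computable function $u$ with $Fol_G(n,\nu(D))\le u(n,D)$ for all $n$ and all $D\subset\subset\mathbb{N}$. For finitely supported $f:\mathbb{N}\to\mathbb{Q}_+$ let $\nu_{G*}(f):G\to\mathbb{R}_+$, $\nu_{G*}(f)(g)=\sum_{i\in\nu^{-1}(g)}f(i)$. For $h:G\to\mathbb{R}_+$ let ${}_xh(g)=h(x^{-1}g)$ and $\|h\|_{1,G}=\sum_{g\in G}|h(g)|$ (and similarly for real-valued functions). $(G,\nu)$ has computable Reiter functions if there is an algorithm which, for every $n$ and every $D\subset\subset\mathbb{N}$, finds a non-zero $f:\mathbb{N}\to\mathbb{Q}_+$ of finite support such that for all $x\in D$: $\frac{\|\nu_{G*}(f)-{}_{\nu(x)}\nu_{G*}(f)\|_{1,G}}{\|\nu_{G*}(f)\|_{1,G}}<\frac1n$. $(G,\nu)$ is $\Sigma$-amenable if there is an algorithm which for all pairs $(n,D)$, $D\subset\subset\mathbb{N}$, finds a set $F\subset\subset\mathbb{N}$ containing a subset $F'$ with $\nu(F')\in\mathfrak{F}ol_{G,\nu(D)}(n)$. $(G,\nu)$ is computably amenable if there is an algorithm which for all pairs $(n,D)$, $D\subset\subset\mathbb{N}$, finds a set $F\subset\subset\mathbb{N}$ such that $\nu(F)\in\mathfrak{F}ol_{G,\nu(D)}(n)$ and $|F|=|\nu(F)|$. *)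

(* Defs.v *)
From HB Require Import structures.
From mathcomp Require Import all_boot all_order all_algebra.
From mathcomp Require Import finmap boolp classical_sets fsbigop constructive_ereal.
Set Implicit Arguments.
Unset Strict Implicit.
Unset Printing Implicit Defensive.
Import Order.TTheory GRing.Theory Num.Theory.

(* Kleene's mu-recursive functions. *)

Inductive code : nat -> Type :=
| Zero : code 0
| Succ : code 1
| Proj k (i : 'I_k) : code k
| Comp m k (f : code m) (g : 'I_m -> code k) : code k
| Prim k (f : code k) (g : code k.+2) : code k.+1
| Mu k (f : code k.+1) : code k.

(* [eval c t v]: the computation of [c] on the input [t] halts with value [v].
   In [Prim], [s i] is the value of the recursion at [i], so that all the
   intermediate values are required to exist; in [Mu], the value [v] is the
   least zero, and all the values before it are required to exist. *)
Fixpoint eval k (c : code k) : k.-tuple nat -> nat -> Prop :=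
  match c in code k return k.-tuple nat -> nat -> Prop with
  | Zero => fun _ v => v = 0
  | Succ => fun t v => v = (thead t).+1
  | Proj _ i => fun t v => v = tnth t i
  | Comp m _ f g => fun t v =>
      exists2 w : m.-tuple nat, forall i, eval (g i) t (tnth w i) & eval f w v
  | Prim _ f g => fun t v => exists s : nat -> nat,
      [/\ eval f [tuple of behead t] (s 0),
          forall i, i < thead t ->
            eval g [tuple of i :: s i :: behead t] (s i.+1)
        & v = s (thead t)]
  | Mu _ f => fun t v => eval f [tuple of v :: t] 0 /\
      forall i, i < v -> exists w, eval f [tuple of i :: t] w.+1
  end.

Lemma eval_fun k (c : code k) t v v' : eval c t v -> eval c t v' -> v = v'.
Proof.
elim: c t v v' => {k} /= [|| k i | m k f IHf g IHg | k f IHf g IHg | k f IHf].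
- by move=> _ v v' -> ->.
- by move=> t v v' -> ->.
- by move=> t v v' -> ->.
- move=> t v v' [w gw fw] [w' gw' fw'].
  suff ww' : w = w' by apply: (IHf w) => //; rewrite ww'.
  by apply: eq_from_tnth => i; apply: (IHg i t).
- move=> t v v' [s [s0 sS ->]] [s' [s'0 s'S ->]].
  suff ss' i : i <= thead t -> s i = s' i by apply: ss'.
  elim: i => [_|i IHi lt_i]; first exact: (IHf _ _ _ s0 s'0).
  have := s'S i lt_i; rewrite -(IHi (ltnW lt_i)); exact: IHg (sS i lt_i).
- move=> t v v' [v0 vS] [v'0 v'S]; case: (ltngtP v v') => // lt_vv'.
  + by have [w /(IHf _ _ _ v0)] := v'S _ lt_vv'.
  + by have [w /(IHf _ _ _ v'0)] := vS _ lt_vv'.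
Qed.

Definition computable k (f : k.-tuple nat -> nat) : Prop :=
  exists c : code k, forall t, eval c t (f t).

Local Open Scope classical_set_scope.

Definition computable_set k (A : set (k.-tuple nat)) : Prop :=
  computable (fun t => `[< A t >] : nat).

(* [A] is empty or listed, possibly with repetitions, by an algorithm. *)
Definition ce_set k (A : set (k.-tuple nat)) : Prop :=
  A = set0 \/
  exists2 e : 'I_k -> 1.-tuple nat -> nat, forall i, computable (e i) &
    A = range (fun m : nat => [tuple e i [tuple m] | i < k]).

Definition canonical_index (D : {fset nat}) : nat := (\sum_(i <- D) 2 ^ i)%N.

Local Open Scope ring_scope.

(* [CodeSeq.decode] is a bijection from [nat] to [seq nat]; the even and odd
   entries of the sequence give the numerators and the predecessors of the
   denominators, and entries beyond its end are 0. *)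
Definition weights (c : nat) (i : nat) : rat :=
  let s := CodeSeq.decode c in
  (nth 0%N s i.*2)%:R / (nth 0%N s i.*2.+1).+1%:R.

Lemma weights_ge0 c i : 0 <= weights c i.
Proof. by rewrite divr_ge0 ?ler0n. Qed.

Lemma weights_finite_support c : exists N, forall i, (N <= i)%N -> weights c i = 0.
Proof.
exists (size (CodeSeq.decode c)) => i le_i.
by rewrite /weights nth_default ?mul0r // -addnn (leq_trans le_i) ?leq_addr.
Qed.

Lemma weights_surj (f : nat -> rat) N :
  (forall i, 0 <= f i) -> (forall i, (N <= i)%N -> f i = 0) ->
  exists c, weights c = f.
Proof.
move=> f_ge0 fN.
pose F j := if odd j then `|denq (f j./2)|.-1%N else `|numq (f j./2)|%N.
exists (CodeSeq.code (mkseq F N.*2)); apply/funext => i.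
rewrite /weights CodeSeq.codeK.
have [lt_iN|le_Ni] := ltnP i N; last first.
  by rewrite nth_default ?mul0r ?fN // size_mkseq leq_double.
rewrite !nth_mkseq ?ltn_double ?ltn_Sdouble // /F /= odd_double /= doubleK.
rewrite uphalf_double.
rewrite prednK ?absz_gt0 ?denq_neq0 //.
have natz (m : nat) : m%:R = (m%:Z)%:~R :> rat by rewrite pmulrn.
rewrite !natz !gez0_abs ?divq_num_den ?numq_ge0 //; exact: denq_ge0.
Qed.

Section NumberedGroups.
Variables (G : groupType) (nu : nat -> G).

Definition numbering : Prop := forall g : G, exists i, nu i = g.

Definition MultT : set (3.-tuple nat) :=
  [set t | (nu (tnth t 0%R) * nu (tnth t 1%R))%g = nu (tnth t 2%R)].

Definition ce_group : Prop := ce_set MultT.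
Definition computable_group : Prop := computable_set MultT.

Definition ltranslate (x : G) (F : {fset G}) : {fset G} :=
  [fset (x * y)%g | y in F]%fset.

Definition Folner (n : nat) (D : {fset G}) : set {fset G} :=
  [set F | F != fset0 /\
    forall x, x \in D ->
      #|` (F `\` ltranslate x F)%fset|%:R / #|` F|%:R <= n%:R^-1 :> rat].

Definition amenable : Prop :=
  forall (n : nat) (D : {fset G}), (0 < n)%N -> Folner n D !=set0.

Definition Folner_function (n : nat) (D : {fset G}) : \bar int :=
  if pselect (exists m, `[< exists2 F, Folner n D F & #|` F| = m >]) is left ex
  then (ex_minn ex)%:Z%:E%E else +oo%E.

Definition image_fset (D : {fset nat}) : {fset G} := [fset nu i | i in D]%fset.

Definition subrecursive_Folner : Prop :=
  exists2 u : 2.-tuple nat -> nat, computable u &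
    forall (n : nat) (D : {fset nat}), (0 < n)%N ->
      (Folner_function n (image_fset D)
         <= (u [tuple n; canonical_index D])%:Z%:E)%E.

Definition push (f : nat -> rat) (g : G) : rat :=
  \sum_(i \in nu @^-1` [set g]) f i.

Definition ftranslate (x : G) (h : G -> rat) (g : G) : rat := h (x^-1 * g)%g.

(* Only meaningful for functions of finite support. *)
Definition l1norm (h : G -> rat) : rat := \sum_(g \in [set: G]) `|h g|.

Definition computable_Reiter : Prop :=
  exists2 r : 2.-tuple nat -> nat, computable r &
    forall (n : nat) (D : {fset nat}), (0 < n)%N ->
      let f := weights (r [tuple n; canonical_index D]) in
      (exists i, f i != 0) /\
      forall x, x \in D ->
        l1norm (push f \- ftranslate (nu x) (push f)) / l1norm (push f)
          < n%:R^-1.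

Definition Sigma_amenable : Prop :=
  exists2 a : 2.-tuple nat -> nat, computable a &
    forall (n : nat) (D : {fset nat}), (0 < n)%N ->
      exists2 F : {fset nat}, a [tuple n; canonical_index D] = canonical_index F &
      exists2 F' : {fset nat}, (F' `<=` F)%fset &
        Folner n (image_fset D) (image_fset F').

Definition computably_amenable : Prop :=
  exists2 a : 2.-tuple nat -> nat, computable a &
    forall (n : nat) (D : {fset nat}), (0 < n)%N ->
      exists2 F : {fset nat}, a [tuple n; canonical_index D] = canonical_index F &
        Folner n (image_fset D) (image_fset F) /\ #|` F| = #|` image_fset F|.

End NumberedGroups.

(* Main.v *)
Require Import Defs.
From HB Require Import structures.
From mathcomp Require Import all_boot all_order all_algebra.
From mathcomp Require Import finmap boolp classical_sets functions fsbigop.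
From mathcomp Require Import constructive_ereal zify.
Set Implicit Arguments.
Unset Strict Implicit.
Unset Printing Implicit Defensive.
Import Order.TTheory GRing.Theory Num.Theory.

(** The four properties are linked by two arguments, one producing Reiter
functions from a search, the other one extracting Folner sets from Reiter
functions.

From amenability to computable Reiter functions: no algorithm need decide
equality in [G], because merging points of [G] can only decrease the l1-norm of
a difference. Fix an enumeration of the true equations [nu i * nu j = nu k]. A
[certificate] for [(n, D)] is a finite non-empty list [L] of numbers together
with, for each [x] in [D], a list of enumerated equations [nu x * nu i = nu j]
with [i] and [j] in [L], the [i]'s being distinct numbers and the [j]'s as well.
In [1_L - x 1_L] the matched terms cancel, so the norm of the push-forward of
this difference is at most twice the number of unmatched elements of [L]
([almost_invariant_indicator]). Being a certificate is decidable, a Folner set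
for the constant [2 n + 1] gives one ([certificate_exists]), and so the search
for a certificate stops ([amenable_Reiter]).

From Reiter functions to Folner sets: after multiplication by a common
denominator, the push-forward [h] of [f] has values in the natural numbers and
is the sum of the indicators of its level sets. If the ratios of norms for the
elements of [D] are less than [1 / (n (|D| + 1))], summation over the levels
and over [D] shows that some level set is an [n]-Folner set
([level_set_Folner], [Reiter_Folner]). It lies in the image of the support of
[f], whose elements are smaller than the code of [f]. This code is then a bound
for the Folner function, and the set of all the numbers below it witnesses
Sigma-amenability. The implications back to amenability are immediate.

Finally, let [(G, nu)] be computably amenable. To decide whether
[nu i * nu j = nu k], search for a number [q] with [nu q * nu k = nu i * nu j],
and let [F] be the [2]-Folner set computed for [{q}]. Since [nu F] meets
[nu q * nu F], one finds [f] and [f'] in [F] with [nu q * nu f = nu f'].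
As [nu] is injective on [F], the equation holds iff [f = f'] as numbers
([witness_sound]).

Effectiveness is dealt with by a small calculus: types are equipped with
encodings by numbers, and [effective] functions between such types are shown to
be closed under the usual operations on numbers, pairs and lists, and under
unbounded search. *)

Local Open Scope nat_scope.

(** * Recursive functions of several variables *)

(** The restriction of [f] to lists of length [k] is computable. Lists instead
of tuples let bound variables be added and removed without type dependencies;
the variable number [j] is [nth 0 s j]. *)
Definition recursive k (f : seq nat -> nat) : Prop :=
  computable (fun t : k.-tuple nat => f t).

Lemma eq_computable k (f g : k.-tuple nat -> nat) :
  f =1 g -> computable f -> computable g.
Proof. by move=> fg [c cP]; exists c => t; rewrite -fg. Qed.

Lemma eq_recursive k f g : f =1 g -> recursive k f -> recursive k g.
Proof. by move=> fg; apply: eq_computable => t. Qed.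

Lemma computable_comp m k (f : m.-tuple nat -> nat)
    (g : 'I_m -> k.-tuple nat -> nat) :
  computable f -> (forall i, computable (g i)) ->
  computable (fun t => f [tuple g i t | i < m]).
Proof.
move=> [c cP] /choice[d dP]; exists (Comp c d) => t /=.
by exists [tuple g i t | i < m] => // i; rewrite tnth_mktuple.
Qed.

Lemma map_enum_ord T n (g : nat -> T) :
  [seq g i | i : 'I_n <- enum 'I_n] = mkseq g n.
Proof. by rewrite /mkseq -val_enum_ord -map_comp. Qed.

Lemma recursive_comp1 k f g : recursive 1 (fun s => f (nth 0 s 0)) ->
  recursive k g -> recursive k (fun s => f (g s)).
Proof.
move=> cf cg; apply: (eq_computable _ (computable_comp cf (fun=> cg))) => t /=.
by rewrite (nth_map ord0) ?size_enum_ord.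
Qed.

Lemma recursive_comp2 k f g h :
  recursive 2 (fun s => f (nth 0 s 0) (nth 0 s 1)) ->
  recursive k g -> recursive k h -> recursive k (fun s => f (g s) (h s)).
Proof.
move=> cf cg ch.
have cgh (i : 'I_2) : recursive k (fun s => if i == 0 :> nat then g s else h s).
  by case: (i == 0 :> nat).
apply: (eq_computable _ (computable_comp cf cgh)) => t /=.
by rewrite (map_enum_ord _ (fun i => if i == 0 then g t else h t)).
Qed.

Lemma recursive_nth k j : recursive k (fun s => nth 0 s j).
Proof.
have [lt_jk|le_kj] := ltnP j k.
  by exists (Proj (Ordinal lt_jk)) => t /=; rewrite (tnth_nth 0).
exists (Comp Zero (fun i : 'I_0 => Proj (False_rect _ (notF (ltn_ord i))))).
move=> t /=; exists [tuple]; first by case.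
by rewrite nth_default ?size_tuple.
Qed.

Lemma recursive_succ k f : recursive k f -> recursive k (fun s => (f s).+1).
Proof.
apply: (@recursive_comp1 _ succn); exists Succ => t /=.
by rewrite nth0; case: t => -[].
Qed.

Lemma recursive_const k c : recursive k (fun=> c).
Proof.
elim: c => [|c]; last exact: (@recursive_succ _ (fun=> c)).
by apply: (eq_computable _ (recursive_nth k k)) => t; rewrite nth_default ?size_tuple.
Qed.

(** Primitive recursion; the step function [h] gets the index and the previous
value as its first two variables. *)
Lemma recursive_iteri k n a h :
  recursive k n -> recursive k a -> recursive k.+2 h ->
  recursive k (fun s => iteri (n s) (fun i r => h [:: i, r & s]) (a s)).
Proof.
move=> cn [c cP] [d dP].
have cprim : recursive k.+1 (fun s => iteri (head 0 s)
    (fun i r => h [:: i, r & behead s]) (a (behead s))).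
  exists (Prim c d) => t.
  have tE : head 0 t = thead t by rewrite (tuple_eta t).
  exists (fun n => iteri n (fun i r => h [:: i, r & behead t]) (a (behead t))).
  split=> [|i _|]; last by rewrite tE.
    by have := cP [tuple of behead t].
  by have /= := dP [tuple of i :: iteri i (fun i r => h [:: i, r & behead t])
    (a (behead t)) :: behead t].
pose g (i : 'I_k.+1) (s : seq nat) := nth 0 (n s :: s) i.
have cg (i : 'I_k.+1) : recursive k (g i).
  by case: i => [[|i] lt_i]; [exact: cn | exact: recursive_nth].
apply: (eq_computable _ (computable_comp cprim cg)) => t /=.
rewrite (map_enum_ord _ (nth 0 (n t :: t))).
suff -> : mkseq (nth 0 (n t :: t)) k.+1 = n t :: t by [].
by rewrite -[RHS](mkseq_nth 0) /= size_tuple.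
Qed.

Ltac rec0 := first [exact: recursive_nth | exact: recursive_const].

Lemma recursive_add k f g : recursive k f -> recursive k g ->
  recursive k (fun s => f s + g s).
Proof.
apply: (@recursive_comp2 _ addn).
apply: (eq_recursive _ (@recursive_iteri _ (fun s => nth 0 s 0)
  (fun s => nth 0 s 1) (fun u => (nth 0 u 1).+1) _ _ _)).
  by move=> s /=; elim: (nth 0 s 0) => //= n ->; rewrite addSn.
all: by try apply: recursive_succ; rec0.
Qed.

Lemma recursive_mul k f g : recursive k f -> recursive k g ->
  recursive k (fun s => f s * g s).
Proof.
apply: (@recursive_comp2 _ muln).
apply: (eq_recursive _ (@recursive_iteri _ (fun s => nth 0 s 0)
  (fun s => 0) (fun u => nth 0 u 3 + nth 0 u 1) _ _ _)).
  by move=> s /=; elim: (nth 0 s 0) => //= n ->; rewrite mulSn.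
all: by try apply: recursive_add; rec0.
Qed.

Lemma recursive_exp k f g : recursive k f -> recursive k g ->
  recursive k (fun s => f s ^ g s).
Proof.
apply: (@recursive_comp2 _ expn).
apply: (eq_recursive _ (@recursive_iteri _ (fun s => nth 0 s 1)
  (fun s => 1) (fun u => nth 0 u 2 * nth 0 u 1) _ _ _)).
  by move=> s /=; elim: (nth 0 s 1) => //= n ->; rewrite expnS.
all: by try apply: recursive_mul; rec0.
Qed.

Lemma recursive_pred k f : recursive k f -> recursive k (fun s => (f s).-1).
Proof.
apply: (@recursive_comp1 _ predn).
apply: (eq_recursive _ (@recursive_iteri _ (fun s => nth 0 s 0)
  (fun s => 0) (fun u => nth 0 u 0) _ _ _)).
  by move=> s /=; case: (nth 0 s 0).
all: by rec0.
Qed.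

Lemma recursive_sub k f g : recursive k f -> recursive k g ->
  recursive k (fun s => f s - g s).
Proof.
apply: (@recursive_comp2 _ subn).
apply: (eq_recursive _ (@recursive_iteri _ (fun s => nth 0 s 1)
  (fun s => nth 0 s 0) (fun u => (nth 0 u 1).-1) _ _ _)).
  by move=> s /=; elim: (nth 0 s 1) => [|n /= ->]; rewrite ?subn0 ?subnS.
all: by try apply: recursive_pred; rec0.
Qed.

Lemma recursive_eq0 k f : recursive k f -> recursive k (fun s => f s == 0).
Proof.
move=> cf; apply: (@eq_recursive _ (fun s => 1 - f s)).
  by move=> s; case: (f s).
by apply: recursive_sub => //; rec0.
Qed.

Lemma recursive_leq k f g : recursive k f -> recursive k g ->
  recursive k (fun s => f s <= g s).
Proof. by move=> cf cg; apply/recursive_eq0/recursive_sub. Qed.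

Lemma recursive_eq k f g : recursive k f -> recursive k g ->
  recursive k (fun s => f s == g s).
Proof.
move=> cf cg; apply: (@eq_recursive _ (fun s => (f s <= g s) * (g s <= f s))).
  by move=> s; rewrite eqn_leq mulnb.
by apply: recursive_mul; apply: recursive_leq.
Qed.

Lemma recursive_sum k n h : recursive k n -> recursive k.+1 h ->
  recursive k (fun s => \sum_(i < n s) h (nat_of_ord i :: s)).
Proof.
move=> cn [c cP].
apply: (eq_recursive _ (@recursive_iteri _ (fun s => n s)
  (fun s => 0) (fun u => nth 0 u 1 + h (nth 0 u 0 :: behead (behead u))) _ _ _)).
- move=> s /=; elim: (n s) => [|m /= ->]; first by rewrite big_ord0.
  by rewrite big_ord_recr /= addnC.
- by [].
- exact: recursive_const.
apply: recursive_add; first exact: recursive_nth.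
pose g (i : 'I_k.+1) (s : seq nat) := nth 0 s (if i == 0 :> nat then 0 else i.+1).
have cg (i : 'I_k.+1) : recursive k.+2 (g i) by exact: recursive_nth.
apply: (eq_computable _ (computable_comp (ex_intro _ c cP) cg)) => t /=.
rewrite (map_enum_ord _ (fun i => nth 0 t (if i == 0 then 0 else i.+1))).
congr h; apply: (@eq_from_nth _ 0) => [|i].
  by rewrite size_mkseq /= !size_behead size_tuple.
rewrite size_mkseq => lt_i; rewrite nth_mkseq //.
by case: i {lt_i} => //= i; rewrite !nth_behead.
Qed.

(** The operator of minimisation, for a total search. *)
Lemma recursive_search f (P : nat -> nat -> bool) :
  recursive 2 (fun s => P (nth 0 s 0) (nth 0 s 1)) ->
  (forall a, P a (f a)) -> (forall a n, P a n -> f a <= n) ->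
  recursive 1 (fun s => f (nth 0 s 0)).
Proof.
move=> cP fP f_min.
have [c cE] : recursive 2 (fun s => (P (nth 0 s 1) (nth 0 s 0) : nat) == 0).
  apply: recursive_eq0.
  by apply: (@recursive_comp2 _ (fun x y => P x y)) => //; exact: recursive_nth.
exists (Mu c) => t /=; split.
  by have /= := cE [tuple of f (nth 0 t 0) :: t]; rewrite fP.
move=> i lt_i; exists 0; have /= := cE [tuple of i :: t].
by case Pi: (P _ i) => //=; move/f_min: Pi; rewrite leqNgt lt_i.
Qed.

(** A bijection from pairs of numbers to numbers. It is chosen so that
[CodeSeq.code (x :: s)] is the successor of the code of [x] and
[CodeSeq.code s]. *)
Definition pair_code x y := (2 ^ x * y.*2.+1).-1.

Lemma succ_pair_code x y : (pair_code x y).+1 = 2 ^ x * y.*2.+1.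
Proof. by rewrite prednK // muln_gt0 expn_gt0. Qed.

Lemma pair_code_surj n : exists x y, pair_code x y = n.
Proof.
have := CodeSeq.decodeK n.+1; case: (CodeSeq.decode _) => // x s sE.
exists x, (CodeSeq.code s).
by rewrite /pair_code -[2 ^ x * _]/(CodeSeq.code (x :: s)) sE.
Qed.

Lemma pair_code_inj x y x' y' :
  pair_code x y = pair_code x' y' -> x = x' /\ y = y'.
Proof.
have E u v : (pair_code u v).+1 = CodeSeq.code (u :: CodeSeq.decode v).
  by rewrite succ_pair_code /= CodeSeq.decodeK.
move=> /(congr1 succn); rewrite !E => /(can_inj CodeSeq.codeK) [-> yE]; split=> //.
exact: can_inj CodeSeq.decodeK _ _ yE.
Qed.

Lemma leq_pair_code x y : x <= pair_code x y /\ y <= pair_code x y.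
Proof.
have x1 : x < 2 ^ x by exact: ltn_expl.
rewrite -ltnS succ_pair_code -[y <= _]ltnS succ_pair_code; split.
  by apply: (leq_trans x1); exact: leq_pmulr.
have /leq_trans-> // : y < y.*2.+1 by rewrite ltnS -addnn leq_addr.
by rewrite leq_pmull // expn_gt0.
Qed.

(** The components of the pair coded by a number. *)
Definition unpair1 n := \sum_(x < n.+1) \sum_(y < n.+1) (pair_code x y == n) * x.
Definition unpair2 n := \sum_(x < n.+1) \sum_(y < n.+1) (pair_code x y == n) * y.

Lemma sum_pair_code x y (F : nat -> nat -> nat) (n := pair_code x y) :
  \sum_(x' < n.+1) \sum_(y' < n.+1) (pair_code x' y' == n) * F x' y' = F x y.
Proof.
have [lex ley] := leq_pair_code x y.
rewrite (bigD1 (inord x)) //= (bigD1 (inord y)) //= !inordK ?ltnS // eqxx mul1n.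
rewrite [X in _ + X]big1 => [|x' nx]; last first.
  rewrite big1 // => y' _; case: eqP => // /pair_code_inj[xx].
  by rewrite -xx inord_val eqxx in nx.
rewrite addn0 [X in _ + X]big1 ?addn0 // => y' ny.
by case: eqP => // /pair_code_inj[_ yy]; rewrite -yy inord_val eqxx in ny.
Qed.

Lemma unpair1K x y : unpair1 (pair_code x y) = x.
Proof. exact: (sum_pair_code x y (fun u _ => u)). Qed.

Lemma unpair2K x y : unpair2 (pair_code x y) = y.
Proof. exact: (sum_pair_code x y (fun _ v => v)). Qed.

Lemma recursive_pair k f g : recursive k f -> recursive k g ->
  recursive k (fun s => pair_code (f s) (g s)).
Proof.
move=> cf cg; apply/recursive_pred/recursive_mul.
  by apply: recursive_exp => //; exact: recursive_const.
apply/recursive_succ/(@eq_recursive _ (fun s => g s + g s)).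
  by move=> s; rewrite addnn.
exact: recursive_add.
Qed.

Lemma recursive_unpair1 k f : recursive k f -> recursive k (fun s => unpair1 (f s)).
Proof.
apply: (@recursive_comp1 _ unpair1); rewrite /unpair1.
apply: (recursive_sum (h := fun s => \sum_(y < (nth 0 s 1).+1)
   (pair_code (nth 0 s 0) y == nth 0 s 1) * nth 0 s 0)).
  by apply/recursive_succ/recursive_nth.
apply: (recursive_sum (h := fun s =>
   (pair_code (nth 0 s 1) (nth 0 s 0) == nth 0 s 2) * nth 0 s 1)).
  by apply/recursive_succ/recursive_nth.
by apply: recursive_mul; try apply: recursive_eq; try apply: recursive_pair; rec0.
Qed.

Lemma recursive_unpair2 k f : recursive k f -> recursive k (fun s => unpair2 (f s)).
Proof.
apply: (@recursive_comp1 _ unpair2); rewrite /unpair2.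
apply: (recursive_sum (h := fun s => \sum_(y < (nth 0 s 1).+1)
   (pair_code (nth 0 s 0) y == nth 0 s 1) * y)).
  by apply/recursive_succ/recursive_nth.
apply: (recursive_sum (h := fun s =>
   (pair_code (nth 0 s 1) (nth 0 s 0) == nth 0 s 2) * nth 0 s 0)).
  by apply/recursive_succ/recursive_nth.
by apply: recursive_mul; try apply: recursive_eq; try apply: recursive_pair; rec0.
Qed.

(** * Effective functions between encoded types *)

(** A type whose elements are encoded by numbers. Injectivity of the encoding
is not required: it plays no role in the closure properties below. *)
Structure encType := EncType { enc_sort :> Type; enc : enc_sort -> nat }.
Arguments enc {_}.

Canonical nat_encType := EncType (fun n : nat => n).
Canonical bool_encType := EncType nat_of_bool.
Canonical prod_encType (A B : encType) :=
  EncType (fun p : A * B => pair_code (enc p.1) (enc p.2)).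
(** On [seq nat] this is [CodeSeq.code], by which [weights] codes functions. *)
Canonical seq_encType (A : encType) :=
  EncType (fun s : seq A => CodeSeq.code (map enc s)).

(** All numbers are codes, as is needed to search for an element by going
through the numbers. *)
Definition enc_surjective (A : encType) := forall n, exists x : A, enc x = n.

Lemma nat_enc_surjective : enc_surjective nat_encType.
Proof. by move=> n; exists n. Qed.

Lemma prod_enc_surjective (A B : encType) :
  enc_surjective A -> enc_surjective B -> enc_surjective (prod_encType A B).
Proof.
move=> encA encB n; have [x [y <-]] := pair_code_surj n.
by have [[a <-] [b <-]] := (encA x, encB y); exists (a, b).
Qed.

Lemma seq_enc_surjective (A : encType) :
  enc_surjective A -> enc_surjective (seq_encType A).
Proof.
move=> /choice[d dP] n; exists (map d (CodeSeq.decode n)).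
by rewrite /= mapK ?CodeSeq.decodeK.
Qed.

Lemma enc_cons (A : encType) (x : A) s :
  enc (x :: s) = (pair_code (enc x) (enc s)).+1.
Proof. by rewrite succ_pair_code. Qed.

Lemma leq_size_enc (A : encType) (s : seq A) : size s <= enc s.
Proof.
elim: s => //= x s IHs.
rewrite -succ_pair_code ltnS (leq_trans IHs) //.
by have [] := leq_pair_code (enc x) (enc s).
Qed.

(** A function is effective if a computable function on numbers sends the code
of each argument to the code of its value. *)
Definition effective (A B : encType) (f : A -> B) : Prop :=
  exists2 F : nat -> nat, recursive 1 (fun s => F (nth 0 s 0)) &
    forall x, F (enc x) = enc (f x).

Lemma eq_effective (A B : encType) (f g : A -> B) :
  f =1 g -> effective f -> effective g.
Proof. by move=> /funext->. Qed.

Lemma effective_comp (A B C : encType) (g : B -> C) (f : A -> B) :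
  effective g -> effective f -> effective (fun x => g (f x)).
Proof.
move=> [G cG GE] [F cF FE]; exists (fun n => G (F n)) => [|x].
  exact: recursive_comp1.
by rewrite FE GE.
Qed.

Lemma effective_id (A : encType) : effective (fun x : A => x).
Proof. by exists id => //; exact: recursive_nth. Qed.

Lemma effective_const (A B : encType) (c : B) : effective (fun _ : A => c).
Proof. by exists (fun=> enc c) => //; exact: recursive_const. Qed.

Lemma effective_pair (A B C : encType) (f : A -> B) (g : A -> C) :
  effective f -> effective g -> effective (fun x => (f x, g x)).
Proof.
move=> [F cF FE] [G cG GE]; exists (fun n => pair_code (F n) (G n)) => [|x].
  exact: recursive_pair.
by rewrite FE GE.
Qed.

Lemma effective_fst (A B C : encType) (f : A -> B * C) :
  effective f -> effective (fun x => (f x).1).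
Proof.
move=> [F cF FE]; exists (fun n => unpair1 (F n)) => [|x].
  exact: recursive_unpair1.
by rewrite FE unpair1K.
Qed.

Lemma effective_snd (A B C : encType) (f : A -> B * C) :
  effective f -> effective (fun x => (f x).2).
Proof.
move=> [F cF FE]; exists (fun n => unpair2 (F n)) => [|x].
  exact: recursive_unpair2.
by rewrite FE unpair2K.
Qed.

Lemma effective_enc (A B : encType) (f : A -> B) :
  effective f -> effective (fun x => enc (f x)).
Proof. by move=> [F cF FE]; exists F. Qed.

(** Binary operations on numbers; [B] is [nat], or [bool] for comparisons. *)
Lemma effective_op2 (A B : encType) (op : nat -> nat -> B) (f g : A -> nat) :
  recursive 2 (fun s => enc (op (nth 0 s 0) (nth 0 s 1))) ->
  effective f -> effective g -> effective (fun x => op (f x) (g x)).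
Proof.
move=> cop [F cF FE] [G cG GE].
exists (fun n => enc (op (F n) (G n))) => [|x]; last by rewrite FE GE.
exact: (recursive_comp2 (f := fun x y => enc (op x y)) cop cF cG).
Qed.

Section Arithmetic.
Variables (A : encType) (f g : A -> nat).
Hypotheses (cf : effective f) (cg : effective g).

Lemma effective_succ : effective (fun x => (f x).+1).
Proof.
by case: cf => F cF FE; exists (fun n => (F n).+1) => [|x];
  [exact: recursive_succ | rewrite FE].
Qed.

Lemma effective_add : effective (fun x => f x + g x).
Proof. by apply: effective_op2 => //; apply: recursive_add; exact: recursive_nth. Qed.

Lemma effective_mul : effective (fun x => f x * g x).
Proof. by apply: effective_op2 => //; apply: recursive_mul; exact: recursive_nth. Qed.

Lemma effective_exp : effective (fun x => f x ^ g x).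
Proof. by apply: effective_op2 => //; apply: recursive_exp; exact: recursive_nth. Qed.

Lemma effective_sub : effective (fun x => f x - g x).
Proof. by apply: effective_op2 => //; apply: recursive_sub; exact: recursive_nth. Qed.

Lemma effective_leq : effective (fun x => f x <= g x).
Proof. by apply: effective_op2 => //; apply: recursive_leq; exact: recursive_nth. Qed.

Lemma effective_eq : effective (fun x => f x == g x).
Proof. by apply: effective_op2 => //; apply: recursive_eq; exact: recursive_nth. Qed.

End Arithmetic.

Lemma effective_if (A B : encType) (b : A -> bool) (f g : A -> B) :
  effective b -> effective f -> effective g ->
  effective (fun x => if b x then f x else g x).
Proof.
move=> [P cP PE] [F cF FE] [G cG GE].
exists (fun n => P n * F n + (1 - P n) * G n) => [|x].
  apply: recursive_add; apply: recursive_mul => //.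
  by apply: recursive_sub => //; exact: recursive_const.
by rewrite PE FE GE /=; case: (b x); rewrite ?mul1n ?addn0.
Qed.

Lemma effective_and (A : encType) (b c : A -> bool) :
  effective b -> effective c -> effective (fun x => b x && c x).
Proof. by move=> cb cc; apply: effective_if => //; exact: effective_const. Qed.

Lemma effective_or (A : encType) (b c : A -> bool) :
  effective b -> effective c -> effective (fun x => b x || c x).
Proof. by move=> cb cc; apply: effective_if => //; exact: effective_const. Qed.

Lemma effective_neg (A : encType) (b : A -> bool) :
  effective b -> effective (fun x => ~~ b x).
Proof. by move=> cb; apply: effective_if => //; exact: effective_const. Qed.

Lemma effective_imply (A : encType) (b c : A -> bool) :
  effective b -> effective c -> effective (fun x => b x ==> c x).
Proof. by move=> cb cc; apply: effective_if => //; exact: effective_const. Qed.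

Lemma effective_iteri (A B : encType) (n : A -> nat) (a : A -> B)
    (h : A -> nat -> B -> B) :
  effective n -> effective a ->
  effective (fun p : A * (nat * B) => h p.1 p.2.1 p.2.2) ->
  effective (fun x => iteri (n x) (h x) (a x)).
Proof.
move=> [N cN NE] [a' ca aE] [H cH HE].
exists (fun x => iteri (N x) (fun i r => H (pair_code x (pair_code i r))) (a' x)).
  apply: (@recursive_iteri 1 (fun s => N (nth 0 s 0)) (fun s => a' (nth 0 s 0))
    (fun s => H (pair_code (nth 0 s 2) (pair_code (nth 0 s 0) (nth 0 s 1))))) => //.
  apply: (recursive_comp1 cH).
  by do 2?[apply: recursive_pair]; exact: recursive_nth.
move=> x; rewrite NE aE /=; elim: (n x) => //= i ->.
exact: HE (x, (i, iteri i (h x) (a x))).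
Qed.

Lemma effective_cons (A B : encType) (f : A -> B) (g : A -> seq B) :
  effective f -> effective g -> effective (fun x => f x :: g x).
Proof.
move=> [F cF FE] [G cG GE]; exists (fun n => (pair_code (F n) (G n)).+1) => [|x].
  by apply/recursive_succ/recursive_pair.
by rewrite enc_cons FE GE.
Qed.

(** One step of the evaluation of [foldl], where a state consists of the
remaining list and of the accumulator. *)
Lemma effective_uncons (A B C : encType) (h : A -> C -> B -> C) :
  effective (fun p : A * (C * B) => h p.1 p.2.1 p.2.2) ->
  effective (fun p : A * (seq B * C) =>
    if p.2.1 is b :: s then (s, h p.1 p.2.2 b) else p.2).
Proof.
move=> [H cH HE].
pose list n := unpair1 (unpair2 n).
pose body n := pair_code (unpair2 (list n).-1)
  (H (pair_code (unpair1 n)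
       (pair_code (unpair2 (unpair2 n)) (unpair1 (list n).-1)))).
exists (fun n => (list n == 0) * unpair2 n + (1 - (list n == 0)) * body n).
  have clist : recursive 1 (fun s => list (nth 0 s 0)).
    exact/recursive_unpair1/recursive_unpair2/recursive_nth.
  have c0 := recursive_eq0 clist.
  have c2 : recursive 1 (fun s => unpair2 (nth 0 s 0)).
    exact/recursive_unpair2/recursive_nth.
  apply: recursive_add; apply: recursive_mul => //.
    by apply: recursive_sub => //; exact: recursive_const.
  apply: recursive_pair; first exact/recursive_unpair2/recursive_pred.
  apply: (recursive_comp1 cH); apply: recursive_pair.
    exact/recursive_unpair1/recursive_nth.
  apply: recursive_pair; first exact: recursive_unpair2.
  exact/recursive_unpair1/recursive_pred.
move=> [a [s c]] /=.
rewrite /body /list !(unpair1K, unpair2K).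
case: s => [|b s]; first by rewrite mul1n addn0.
rewrite -[CodeSeq.code _]/(enc (b :: s)) enc_cons mul0n add0n subn0 mul1n /=.
by rewrite !(unpair1K, unpair2K); have /= -> := HE (a, (c, b)).
Qed.

Lemma effective_foldl (A B C : encType) (h : A -> C -> B -> C) (a : A -> C)
    (s : A -> seq B) :
  effective (fun p : A * (C * B) => h p.1 p.2.1 p.2.2) ->
  effective a -> effective s -> effective (fun x => foldl (h x) (a x) (s x)).
Proof.
move=> ch ca cs.
pose step (x : A) (_ : nat) (p : seq B * C) :=
  if p.1 is b :: s then (s, h x p.2 b) else p.
apply: (@eq_effective _ _ (fun x => (iteri (enc (s x)) (step x) (s x, a x)).2)).
  move=> x.
  have stepE n l c : iteri n (step x) (l, c) =
      (drop n l, foldl (h x) c (take n l)).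
    elim: n => [|n IHn] /=; first by rewrite drop0 take0.
    rewrite IHn /step /=; have [lt_n|le_n] := ltnP n (size l).
      case: l lt_n {IHn} => // b l lt_n.
      by rewrite (drop_nth b lt_n) (take_nth b lt_n) foldl_rcons.
    by rewrite !drop_oversize ?take_oversize // leqW.
  by rewrite stepE take_oversize // leq_size_enc.
apply/effective_snd/effective_iteri; first exact: effective_enc.
  exact: effective_pair.
apply: (effective_comp (f := fun p => (p.1, p.2.2)) (effective_uncons ch)).
apply: effective_pair; first exact/effective_fst/effective_id.
exact/effective_snd/effective_snd/effective_id.
Qed.

Lemma effective_rev (A B : encType) (s : A -> seq B) :
  effective s -> effective (fun x => rev (s x)).
Proof.
move=> cs; apply: (@eq_effective _ _ (fun x => foldl (fun r b => b :: r) [::] (s x))).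
  by move=> x; rewrite /rev; elim: (s x) [::] => /=.
apply: effective_foldl => //; last exact: effective_const.
apply: effective_cons; first exact/effective_snd/effective_snd/effective_id.
exact/effective_fst/effective_snd/effective_id.
Qed.

Lemma effective_foldr (A B C : encType) (h : A -> B -> C -> C) (a : A -> C)
    (s : A -> seq B) :
  effective (fun p : A * (B * C) => h p.1 p.2.1 p.2.2) ->
  effective a -> effective s -> effective (fun x => foldr (h x) (a x) (s x)).
Proof.
move=> ch ca cs.
apply: (@eq_effective _ _ (fun x => foldl (fun c b => h x b c) (a x) (rev (s x)))).
  by move=> x; rewrite foldl_rev.
apply: effective_foldl ca (effective_rev cs).
apply: (effective_comp (f := fun p => (p.1, (p.2.2, p.2.1))) ch).
apply: effective_pair; first exact/effective_fst/effective_id.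
apply: effective_pair; first exact/effective_snd/effective_snd/effective_id.
exact/effective_fst/effective_snd/effective_id.
Qed.

Section Sequences.
Variables A B C : encType.

Lemma effective_map (f : A -> B -> C) (s : A -> seq B) :
  effective (fun p : A * B => f p.1 p.2) -> effective s ->
  effective (fun x => [seq f x y | y <- s x]).
Proof.
move=> cf cs.
apply: (@eq_effective _ _ (fun x => foldr (fun y r => f x y :: r) [::] (s x))).
  by move=> x; elim: (s x) => //= y r ->.
apply: effective_foldr => //; last exact: effective_const.
apply: effective_cons; last exact/effective_snd/effective_snd/effective_id.
apply: (effective_comp (f := fun q => (q.1, q.2.1)) cf).
apply: effective_pair.
  exact/effective_fst/effective_id.
exact/effective_fst/effective_snd/effective_id.
Qed.

Lemma effective_has (p : A -> B -> bool) (s : A -> seq B) :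
  effective (fun q : A * B => p q.1 q.2) -> effective s ->
  effective (fun x => has (p x) (s x)).
Proof.
move=> cp cs.
apply: (@eq_effective _ _ (fun x => foldr (fun y r => p x y || r) false (s x))).
  by move=> x; elim: (s x) => //= y r ->.
apply: effective_foldr => //; last exact: effective_const.
apply: effective_or; last exact/effective_snd/effective_snd/effective_id.
apply: (effective_comp (f := fun q => (q.1, q.2.1)) cp).
apply: effective_pair.
  exact/effective_fst/effective_id.
exact/effective_fst/effective_snd/effective_id.
Qed.

Lemma effective_all (p : A -> B -> bool) (s : A -> seq B) :
  effective (fun q : A * B => p q.1 q.2) -> effective s ->
  effective (fun x => all (p x) (s x)).
Proof.
move=> cp cs.
apply: (@eq_effective _ _ (fun x => ~~ has (fun y => ~~ p x y) (s x))).
  by move=> x; rewrite -all_predC; apply: eq_all => y /=; rewrite negbK.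
by apply/effective_neg/effective_has => //; exact: effective_neg.
Qed.

Lemma effective_size (s : A -> seq B) :
  effective s -> effective (fun x => size (s x)).
Proof.
move=> cs.
apply: (@eq_effective _ _ (fun x => foldr (fun _ n => n.+1) 0 (s x))).
  by move=> x; elim: (s x) => //= y r ->.
apply: effective_foldr => //; last exact: effective_const.
exact/effective_succ/effective_snd/effective_snd/effective_id.
Qed.

Lemma effective_mkseq (f : A -> nat -> B) (n : A -> nat) :
  effective (fun p : A * nat => f p.1 p.2) -> effective n ->
  effective (fun x => mkseq (f x) (n x)).
Proof.
move=> cf cn.
apply: (@eq_effective _ _ (fun x => rev (iteri (n x) (fun i r => f x i :: r) [::]))).
  move=> x; elim: (n x) => //= m; rewrite rev_cons => ->.
  by rewrite /mkseq -addn1 iotaD map_cat cats1.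
apply/effective_rev/effective_iteri => //; first exact: effective_const.
apply: effective_cons; last exact/effective_snd/effective_snd/effective_id.
apply: (effective_comp (f := fun q => (q.1, q.2.1)) cf).
apply: effective_pair.
  exact/effective_fst/effective_id.
exact/effective_fst/effective_snd/effective_id.
Qed.

End Sequences.

Lemma effective_iota (A : encType) (n : A -> nat) :
  effective n -> effective (fun x => iota 0 (n x)).
Proof.
move=> cn; apply: (@eq_effective _ _ (fun x => mkseq id (n x))).
  by move=> x; rewrite /mkseq map_id.
apply: effective_mkseq => //; exact/effective_snd/effective_id.
Qed.

Lemma effective_mem (A : encType) (x : A -> nat) (s : A -> seq nat) :
  effective x -> effective s -> effective (fun a => x a \in s a).
Proof.
move=> cx cs.
apply: (@eq_effective _ _ (fun a => has (fun y => y == x a) (s a))).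
  by move=> a; rewrite has_pred1.
apply: effective_has => //; apply: effective_eq.
  exact/effective_snd/effective_id.
exact/(effective_comp cx)/effective_fst/effective_id.
Qed.

Lemma effective_uniq (A : encType) (s : A -> seq nat) :
  effective s -> effective (fun x => uniq (s x)).
Proof.
move=> cs.
pose h (y : nat) (p : seq nat * bool) := (y :: p.1, (y \notin p.1) && p.2).
apply: (@eq_effective _ _ (fun x => (foldr h ([::], true) (s x)).2)).
  move=> x; suff -> : foldr h ([::], true) (s x) = (s x, uniq (s x)) by [].
  by elim: (s x) => //= y r ->.
apply/effective_snd/effective_foldr => //; last exact: effective_const.
have c1 : effective (fun p : A * (nat * (seq nat * bool)) => p.2.1).
  exact/effective_fst/effective_snd/effective_id.
have c2 : effective (fun p : A * (nat * (seq nat * bool)) => p.2.2).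
  exact/effective_snd/effective_snd/effective_id.
apply: effective_pair; first exact/(effective_cons c1)/effective_fst.
apply: effective_and; last exact: effective_snd.
exact/effective_neg/(effective_mem c1)/effective_fst.
Qed.

Lemma effective_odd (A : encType) (n : A -> nat) :
  effective n -> effective (fun x => odd (n x)).
Proof.
move=> cn; apply: (@eq_effective _ _ (fun x => iteri (n x) (fun _ b => ~~ b) false)).
  by move=> x; elim: (n x) => //= m ->.
apply: effective_iteri => //; first exact: effective_const.
exact/effective_neg/effective_snd/effective_snd/effective_id.
Qed.

Lemma effective_half (A : encType) (n : A -> nat) :
  effective n -> effective (fun x => (n x)./2).
Proof.
move=> cn.
apply: (@eq_effective _ _ (fun x => (iteri (n x) (fun _ p => (p.2, p.1.+1)) (0, 0)).1)).
  move=> x; suff -> : iteri (n x) (fun _ p => (p.2, p.1.+1)) (0, 0) =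
    ((n x)./2, uphalf (n x)) by [].
  by elim: (n x) => //= m ->; rewrite uphalfE.
apply/effective_fst/effective_iteri => //; first exact: effective_const.
apply: effective_pair.
  exact/effective_snd/effective_snd/effective_snd/effective_id.
exact/effective_succ/effective_fst/effective_snd/effective_snd/effective_id.
Qed.

(** The binary digit of [d] of rank [i]. *)
Definition bit (d i : nat) : bool := odd (d %/ 2 ^ i).

Lemma effective_bit (A : encType) (d i : A -> nat) :
  effective d -> effective i -> effective (fun x => bit (d x) (i x)).
Proof.
move=> cd ci; apply: effective_odd.
apply: (@eq_effective _ _ (fun x => iteri (i x) (fun _ m => m./2) (d x))).
  move=> x; elim: (i x) => /= [|j ->]; first by rewrite divn1.
  by rewrite -divn2 -divnMA expnSr.
apply: effective_iteri => //.
exact/effective_half/effective_snd/effective_snd/effective_id.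
Qed.

(** Proves effectiveness by following the syntax of a function, given the
effectiveness of its unknown constituents in the context. [effective_enc] comes
last because on [nat] it can apply without making progress. *)
Ltac eff := repeat first
  [ assumption | exact: effective_id | exact: effective_const
  | apply: effective_fst | apply: effective_snd | apply: effective_pair
  | apply: effective_succ | apply: effective_add | apply: effective_mul
  | apply: effective_sub | apply: effective_exp
  | apply: effective_leq | apply: effective_eq | apply: effective_bit
  | apply: effective_odd | apply: effective_half
  | apply: effective_and | apply: effective_or | apply: effective_neg
  | apply: effective_imply
  | apply: effective_mem | apply: effective_uniq | apply: effective_size
  | apply: effective_iota | apply: effective_map | apply: effective_all
  | apply: effective_has | apply: effective_mkseq
  | match goal with c : effective _ |- _ =>
      apply: (effective_comp c) end
  | apply: effective_enc ].

(** Unbounded search. Codes must exhaust the numbers on both sides: otherwise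
the search could fail to stop on a number that codes no argument, or could stop
on a number that codes no result. *)
Lemma effective_search (A C : encType) (P : A -> C -> bool) :
  enc_surjective A -> enc_surjective C ->
  effective (fun p : A * C => P p.1 p.2) -> (forall a, exists c, P a c) ->
  exists2 f : A -> C, effective f & forall a, P a (f a).
Proof.
move=> surjA /choice[d dK] [F cF FE] exP.
have exF m : exists w, 0 < F (pair_code m w).
  have [a <-] := surjA m; have [c Pac] := exP a; exists (enc c).
  by rewrite (FE (a, c)) /= Pac.
pose f m := ex_minn (exF m).
exists (fun a => d (f (enc a))) => [|a].
  exists f => [|a]; last by rewrite dK.
  apply: (@recursive_search f (fun m w => 0 < F (pair_code m w))) => [|m|m w].
  - apply: recursive_leq; first exact: recursive_const.
    apply: (recursive_comp1 cF).
    by apply: recursive_pair; exact: recursive_nth.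
  - by rewrite /f; case: ex_minnP.
  - by rewrite /f; case: ex_minnP => w' _ /[apply].
suff : 0 < F (pair_code (enc a) (enc (d (f (enc a))))).
  by rewrite (FE (a, _)) /= lt0b.
by rewrite dK /f; case: ex_minnP.
Qed.

Lemma effective_tuple (A : encType) k (f : k.-tuple nat -> nat)
    (g : 'I_k -> A -> nat) :
  computable f -> (forall i, effective (g i)) ->
  effective (fun x => f [tuple g i x | i < k]).
Proof.
move=> cf cg.
have /choice[G GP] i : exists G : nat -> nat,
    recursive 1 (fun s => G (nth 0 s 0)) /\ forall x, G (enc x) = g i x.
  by have [G cG GE] := cg i; exists G.
exists (fun n => f [tuple G i n | i < k]) => [|x].
  apply: (@computable_comp _ 1 f (fun i t => G i (nth 0 t 0))) => // i.
  by case: (GP i).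
by congr f; apply: eq_from_tnth => i; rewrite !tnth_mktuple; case: (GP i).
Qed.

Lemma effective_tuple1 (A : encType) (f : 1.-tuple nat -> nat) (g : A -> nat) :
  computable f -> effective g -> effective (fun x => f [tuple g x]).
Proof.
move=> cf cg; apply: eq_effective (effective_tuple cf (fun=> cg)) => x.
congr f; apply: val_inj.
by rewrite /= (map_enum_ord _ (fun=> g x)).
Qed.

Lemma effective_tuple2 (A : encType) (f : 2.-tuple nat -> nat) (g h : A -> nat) :
  computable f -> effective g -> effective h ->
  effective (fun x => f [tuple g x; h x]).
Proof.
move=> cf cg ch.
have cgh (i : 'I_2) : effective (fun x => if i == 0 :> nat then g x else h x).
  by case: (i == 0 :> nat).
apply: eq_effective (effective_tuple cf cgh) => x.
congr f; apply: val_inj.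
by rewrite /= (map_enum_ord _ (fun i => if i == 0 then g x else h x)).
Qed.

Lemma computable_effective2 (f : nat * nat -> nat) :
  effective f -> computable (fun t : 2.-tuple nat => f (tnth t 0%R, tnth t 1%R)).
Proof.
move=> [F cF FE]; apply: (@eq_computable _ (fun t =>
  F (pair_code (nth 0 t 0) (nth 0 t 1)))); last first.
  apply: (@recursive_comp1 2 F (fun s => pair_code (nth 0 s 0) (nth 0 s 1)) cF).
  by apply: recursive_pair; exact: recursive_nth.
by move=> t; rewrite !(tnth_nth 0); exact: FE (_, _).
Qed.

Lemma computable_effective3 (f : nat * (nat * nat) -> bool) :
  effective f -> computable (fun t : 3.-tuple nat =>
    f (tnth t 0%R, (tnth t 1%R, tnth t 2%R)) : nat).
Proof.
move=> [F cF FE]; apply: (@eq_computable _ (fun t =>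
  F (pair_code (nth 0 t 0) (pair_code (nth 0 t 1) (nth 0 t 2))))); last first.
  apply: (@recursive_comp1 3 F (fun s => pair_code (nth 0 s 0)
    (pair_code (nth 0 s 1) (nth 0 s 2))) cF).
  by do 2?[apply: recursive_pair]; exact: recursive_nth.
by move=> t; rewrite !(tnth_nth 0); exact: FE (_, (_, _)).
Qed.

(** * Bits of canonical indices *)

Lemma bit_sum (b : nat -> bool) N i :
  bit (\sum_(j < N) b j * 2 ^ j) i = (i < N) && b i.
Proof.
elim: i b N => [|i IHi] b [|N]; rewrite /bit ?big_ord0 ?div0n //.
  rewrite divn1 big_ord_recl /= muln1 oddD oddb.
  rewrite (eq_bigr (fun j : 'I_N => 2 * (b j.+1 * 2 ^ j))) => [|j _].
    by rewrite -big_distrr oddM addbF.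
  by rewrite /bump add1n expnS mulnCA.
rewrite expnS divnMA big_ord_recl /= muln1.
rewrite (eq_bigr (fun j : 'I_N => 2 * (b j.+1 * 2 ^ j))) => [|j _]; last first.
  by rewrite /bump add1n expnS mulnCA.
have b0 : b 0 %/ 2 = 0 by case: (b 0).
rewrite -big_distrr /= addnC mulnC divnMDl // addnC b0 add0n.
exact: (IHi (fun j => b j.+1)).
Qed.

Lemma canonical_indexE (D : {fset nat}) N : (forall i, i \in D -> i < N) ->
  canonical_index D = \sum_(j < N) (nat_of_ord j \in D) * 2 ^ j.
Proof.
move=> DN; rewrite -(big_mkord xpredT (fun j => (j \in D) * 2 ^ j)) /index_iota subn0.
rewrite (eq_bigr (fun j => if j \in D then 2 ^ j else 0)) => [|j _]; last first.
  by case: ifP; rewrite ?mul1n.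
rewrite -big_mkcond -big_filter; apply: perm_big; apply: uniq_perm.
- exact: fset_uniq.
- by rewrite filter_uniq // iota_uniq.
- by move=> j; rewrite mem_filter mem_iota /=; case: (boolP (j \in D)) => // /DN ->.
Qed.

Lemma bit_canonical_index (D : {fset nat}) i : bit (canonical_index D) i = (i \in D).
Proof.
have DN j : j \in D -> j < (\max_(k <- D) k).+1.
  by move=> Dj; rewrite ltnS (@leq_bigmax_seq _ _ predT id).
rewrite (canonical_indexE DN) (bit_sum (fun j => j \in D)).
by apply: andb_idl; exact: DN.
Qed.

Lemma card_leq_canonical_index (D : {fset nat}) : #|` D| <= canonical_index D.
Proof.
rewrite -[X in X <= _]sum1_size; apply: leq_sum => i _; exact: expn_gt0.
Qed.

Lemma bit_lt d i : bit d i -> i < d.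
Proof.
rewrite /bit => odd_d; rewrite ltnNge; apply/negP => le_di.
have lt_d : d < 2 ^ i by apply: leq_ltn_trans le_di _; exact: ltn_expl.
by rewrite (divn_small lt_d) in odd_d.
Qed.

Lemma canonical_index_iota c : canonical_index [fset i in iota 0 c]%fset = 2 ^ c - 1.
Proof.
rewrite (@canonical_indexE _ c) => [|i]; last by rewrite inE mem_iota.
rewrite subn1 predn_exp mul1n; apply: eq_bigr => i _.
by rewrite inE mem_iota /= ltn_ord mul1n.
Qed.

Lemma canonical_index1 i : canonical_index [fset i]%fset = 2 ^ i.
Proof. by rewrite /canonical_index big_seq_fset1. Qed.

(** * Push-forwards and l1-norms *)

Local Open Scope ring_scope.

(** The indicator function of the set of the elements of [L]. *)
Definition indicator (L : seq nat) (i : nat) : rat := (i \in L)%:R.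

Section Norms.
Variables (G : groupType) (nu : nat -> G).

Lemma pushE (f : nat -> rat) (s : seq nat) g : uniq s ->
  (forall i, i \notin s -> f i = 0) ->
  push nu f g = \sum_(i <- s) if nu i == g then f i else 0.
Proof.
move=> s_uniq fs; rewrite /push fsbig_mkcond (fsbigE s) //.
  rewrite big_mkcond; apply: eq_bigr => i _ /=.
  rewrite ifT ?inE // /patch.
  have -> : (i \in nu @^-1` [set g])%classic = (nu i == g).
    by apply/idP/eqP; rewrite inE.
  by [].
by move=> i _ /fs fi; rewrite /patch fi; case: ifP.
Qed.

Lemma l1normE (h : G -> rat) (S : seq G) : uniq S ->
  (forall g, g \notin S -> h g = 0) -> l1norm h = \sum_(g <- S) `|h g|.
Proof.
move=> S_uniq hS; rewrite /l1norm (fsbigE S) //.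
  by apply: eq_bigl => i; exact: mem_set.
by move=> i _ /hS ->; rewrite normr0.
Qed.

(** The multiplicity of [g] in [A]; as a function on [G], the sum of the unit masses
at the elements of the list [A]. *)
Definition multiplicity (A : seq G) (g : G) : rat := (count_mem g A)%:R.

Lemma multiplicity_notin A g : g \notin A -> multiplicity A g = 0.
Proof. by move=> /count_memPn; rewrite /multiplicity => ->. Qed.

Lemma multiplicity_cat A B g :
  multiplicity (A ++ B) g = multiplicity A g + multiplicity B g.
Proof. by rewrite /multiplicity count_cat natrD. Qed.

Lemma perm_multiplicity A B : perm_eq A B -> multiplicity A =1 multiplicity B.
Proof. by move=> /permP AB g; rewrite /multiplicity AB. Qed.

Lemma sum_multiplicity A (S : seq G) : uniq S -> {subset A <= S} ->
  \sum_(g <- S) multiplicity A g = (size A)%:R.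
Proof.
move=> S_uniq; elim: A => [|a A IHA] AS; first by rewrite big1_eq.
rewrite -[a :: A]cat1s size_cat natrD -IHA => [|b Ab]; last first.
  by rewrite AS // inE Ab orbT.
rewrite (eq_bigr _ (fun g _ => multiplicity_cat [:: a] A g)) big_split /=.
congr (_ + _).
rewrite (bigD1_seq a) ?AS ?mem_head //= /multiplicity /= eqxx big1 ?addr0 // => g ga.
by rewrite eq_sym (negPf ga).
Qed.

Lemma l1norm_multiplicity A : l1norm (multiplicity A) = (size A)%:R.
Proof.
rewrite (@l1normE _ (undup A)) ?undup_uniq // => [|g]; last first.
  by rewrite mem_undup; exact: multiplicity_notin.
rewrite (eq_bigr (multiplicity A)) => [|g _]; last by rewrite ger0_norm ?ler0n.
by apply: sum_multiplicity => [|g]; rewrite ?undup_uniq ?mem_undup.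
Qed.

Lemma l1norm_sub_multiplicity A B :
  l1norm (multiplicity A \- multiplicity B) <= (size A + size B)%:R.
Proof.
set S := undup (A ++ B).
have SE g : (g \in S) = (g \in A) || (g \in B) by rewrite mem_undup mem_cat.
rewrite (@l1normE _ S) ?undup_uniq // => [|g]; last first.
  by rewrite SE => /norP[gA gB] /=; rewrite !multiplicity_notin ?subr0.
rewrite natrD -(@sum_multiplicity A S) ?undup_uniq // => [|g gA]; last by rewrite SE gA.
rewrite -(@sum_multiplicity B S) ?undup_uniq // => [|g gB]; last by rewrite SE gB orbT.
rewrite -big_split; apply: ler_sum => g _ /=.
by rewrite (le_trans (ler_normB _ _)) // !ger0_norm ?ler0n.
Qed.

Lemma push_indicator (L : seq nat) : uniq L ->
  push nu (indicator L) =1 multiplicity [seq nu i | i <- L].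
Proof.
move=> L_uniq g; rewrite (@pushE _ L) //; last first.
  by move=> i /negPf; rewrite /indicator => ->.
rewrite /multiplicity count_map -sum1_count natr_sum [RHS]big_mkcond /=.
by rewrite !big_seq; apply: eq_bigr => i; rewrite /indicator => ->.
Qed.

Lemma perm_cat_filter (T : eqType) (P L : seq T) : uniq P -> uniq L ->
  {subset P <= L} -> perm_eq L (P ++ [seq i <- L | i \notin P]).
Proof.
move=> P_uniq L_uniq PL; apply: uniq_perm => //.
  rewrite cat_uniq P_uniq filter_uniq // andbT /=.
  by apply/hasPn => i; rewrite mem_filter => /andP[].
move=> i; rewrite mem_cat mem_filter.
by case: (boolP (i \in P)) => // /PL ->.
Qed.

(** In [1_L - x 1_L], pushed to [G], the pairs [(i, j)] of [P] cancel, so that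
only the [size L - size P] unmatched elements on each side contribute. *)
Lemma almost_invariant_indicator (L : seq nat) (x : G) (P : seq (nat * nat)) n :
  (0 < n)%N -> uniq L -> uniq (unzip1 P) -> uniq (unzip2 P) ->
  {subset unzip1 P <= L} -> {subset unzip2 P <= L} ->
  (forall i j, (i, j) \in P -> (x * nu i)%g = nu j) ->
  (2 * n * (size L - size P) < size L)%N ->
  l1norm (push nu (indicator L) \- ftranslate x (push nu (indicator L))) /
    l1norm (push nu (indicator L)) < n%:R^-1.
Proof.
move=> n_gt0 L_uniq P1_uniq P2_uniq P1L P2L PG ltL.
set h := push nu (indicator L).
have hE : h = multiplicity [seq nu i | i <- L] by apply/funext/push_indicator.
have xhE : ftranslate x h = multiplicity [seq (x * nu i)%g | i <- L].
  apply/funext => g; rewrite /ftranslate hE /multiplicity !count_map; congr _%:R.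
  by apply: eq_count => i /=; rewrite -(inj_eq (mulgI x)) mulVKg.
set L1 := [seq i <- L | i \notin unzip1 P].
set L2 := [seq i <- L | i \notin unzip2 P].
have perm1 : perm_eq L (unzip1 P ++ L1) by exact: perm_cat_filter.
have perm2 : perm_eq L (unzip2 P ++ L2) by exact: perm_cat_filter.
have size1 : (size L1 = size L - size P)%N.
  by rewrite (perm_size perm1) size_cat size_map addKn.
have size2 : (size L2 = size L - size P)%N.
  by rewrite (perm_size perm2) size_cat size_map addKn.
have PE : [seq (x * nu i)%g | i <- unzip1 P] = [seq nu i | i <- unzip2 P].
  by rewrite -!map_comp; apply/eq_in_map => -[i j] /PG.
have -> : h \- ftranslate x h =
    multiplicity [seq nu i | i <- L2] \- multiplicity [seq (x * nu i)%g | i <- L1].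
  apply/funext => g /=; rewrite xhE hE.
  rewrite (perm_multiplicity (perm_map nu perm2)).
  rewrite (perm_multiplicity (perm_map (fun i => (x * nu i)%g) perm1)).
  rewrite !map_cat PE !multiplicity_cat.
  by rewrite opprD addrACA subrr add0r.
rewrite hE l1norm_multiplicity size_map.
have L_gt0 : 0 < (size L)%:R :> rat by rewrite ltr0n; case: (size L) ltL.
rewrite ltr_pdivrMr // ltr_pdivlMl ?ltr0n //.
apply: le_lt_trans (ler_wpM2l _ (l1norm_sub_multiplicity _ _)) _; rewrite ?ler0n //.
by rewrite -natrM ltr_nat !size_map size1 size2 addnn -mul2n mulnA [(n * 2)%N]mulnC.
Qed.
End Norms.

(** * Folner sets as level sets *)

Lemma common_denominator (s : seq rat) : {in s, forall a, 0 <= a} ->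
  exists2 q : nat, (0 < q)%N & {in s, forall a, exists m : nat, q%:R * a = m%:R}.
Proof.
elim: s => [|a s IHs] s_ge0; first by exists 1%N.
have [|q q_gt0 qP] := IHs; first by move=> b sb; rewrite s_ge0 // inE sb orbT.
have a_ge0 : 0 <= a by rewrite s_ge0 ?mem_head.
exists (`|denq a| * q)%N => [|b].
  by rewrite muln_gt0 q_gt0 absz_gt0 denq_neq0.
rewrite inE => /predU1P[->|/qP[m qm]]; last first.
  by exists (`|denq a| * m)%N; rewrite natrM -mulrA qm natrM.
exists (q * `|numq a|)%N; rewrite !natrM [_ * q%:R]mulrC -mulrA; congr (_ * _).
by rewrite !pmulrn !gez0_abs ?denq_ge0 ?numq_ge0 // numqE mulrC.
Qed.

(** A truncated difference is the number of thresholds that separate its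
arguments. *)
Lemma sum_threshold (a b M : nat) : (a <= M)%N ->
  (\sum_(t < M) ((t < a) && (b <= t)) = a - b)%N.
Proof.
move=> aM; suff -> : (\sum_(t < M) ((t < a) && (b <= t)) = minn a M - b)%N by lia.
by elim: M {aM} => [|M IHM]; rewrite ?big_ord0 ?big_ord_recr /= ?IHM; lia.
Qed.

Section LevelSets.
Variables (G : groupType) (nu : nat -> G).

Lemma mem_ltranslate (x y : G) (F : {fset G}) :
  (y \in ltranslate x F) = ((x^-1 * y)%g \in F).
Proof.
apply/imfsetP/idP => [[z Fz ->]|Fy]; first by rewrite mulKg.
by exists (x^-1 * y)%g; rewrite ?mulVKg.
Qed.

(** The condition of Folner without fractions. *)
Lemma FolnerP n (D : {fset G}) (F : {fset G}) : (0 < n)%N ->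
  Folner n D F <-> F != fset0 /\
    forall x, x \in D -> (n * #|` (F `\` ltranslate x F)%fset| <= #|` F|)%N.
Proof.
move=> n_gt0; rewrite /Folner /=.
have E x : F != fset0 -> (#|` (F `\` ltranslate x F)%fset|%:R / #|` F|%:R
    <= n%:R^-1 :> rat) = (n * #|` (F `\` ltranslate x F)%fset| <= #|` F|)%N.
  move=> F0; rewrite ler_pdivrMr ?ltr0n ?cardfs_gt0 //.
  by rewrite ler_pdivlMl ?ltr0n // -natrM ler_nat.
by split=> -[F0 FD]; split=> // x /FD; rewrite E.
Qed.

(** If [h] is almost invariant under left translation by each element of [D],
then one of its level sets is a Folner set: otherwise the sum over all levels
[t] and over [D] of the inequalities satisfied by the level sets would
contradict the almost invariance of [h]. *)
Lemma level_set_Folner (S : seq G) (h : G -> nat) (D : seq G) n : uniq S ->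
  (forall g, g \notin S -> h g = 0%N) -> (exists g, h g != 0%N) ->
  (forall x, x \in D -> n * (size D).+1 *
     \sum_(g <- S) (h g - h (x^-1 * g)%g) <= \sum_(g <- S) h g)%N ->
  exists2 F : {fset G}, F != fset0 /\ {subset F <= S} &
    forall x, x \in D -> (n * #|` (F `\` ltranslate x F)%fset| <= #|` F|)%N.
Proof.
move=> S_uniq hS [g0 hg0] hD.
pose F t := [fset g in S | (t < h g)%N]%fset.
have FE t g : (g \in F t) = (t < h g)%N.
  by rewrite !inE /=; case: (boolP (g \in S)) => //= /hS ->.
pose M := \max_(g <- S) h g.
have hM g : (h g <= M)%N.
  have [gS|/hS->//] := boolP (g \in S).
  exact: (@leq_bigmax_seq _ _ predT h).
have cardE (K : {fset G}) : {subset K <= S} -> #|` K| = (\sum_(g <- S) (g \in K))%N.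
  move=> KS; transitivity (count (mem K) S); last first.
    by rewrite -sumn_count sumnE big_map.
  rewrite -size_filter; apply: perm_size.
  apply: uniq_perm; rewrite ?fset_uniq ?filter_uniq // => g.
  by rewrite mem_filter andb_idr //; exact: KS.
have FS t : {subset F t <= S} by move=> g; rewrite !inE /= => /andP[].
have sumF : (\sum_(t < M) #|` F t| = \sum_(g <- S) h g)%N.
  rewrite (eq_bigr (fun t : 'I_M => \sum_(g <- S) (t < h g) && (0 <= t))%N).
    rewrite exchange_big /=; apply: eq_bigr => g _.
    by rewrite sum_threshold // subn0.
  by move=> t _; rewrite cardE //; apply: eq_bigr => g _; rewrite FE andbT.
have sumFx x : (\sum_(t < M) #|` (F t `\` ltranslate x (F t))%fset| =
    \sum_(g <- S) (h g - h (x^-1 * g)%g))%N.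
  rewrite (eq_bigr (fun t : 'I_M =>
    \sum_(g <- S) (t < h g) && (h (x^-1 * g)%g <= t))%N).
    by rewrite exchange_big /=; apply: eq_bigr => g _; rewrite sum_threshold.
  move=> t _; rewrite cardE => [|g]; last by rewrite inE => /andP[_ /FS].
  apply: eq_bigr => g _.
  by rewrite inE mem_ltranslate !FE -leqNgt andbC.
pose good (t : nat) := (F t != fset0) &&
  all (fun x => n * #|` (F t `\` ltranslate x (F t))%fset| <= #|` F t|)%N D.
have [/hasP[t _ /andP[F0 /allP FD]]|/hasPn bad] := boolP (has good (iota 0 M)).
  by exists (F t).
have badE (t : 'I_M) : (#|` F t| <=
    \sum_(x <- D) n * #|` (F t `\` ltranslate x (F t))%fset|)%N.
  have := bad t; rewrite mem_iota ltn_ord /good => /(_ isT).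
  have [->|F0 /=] := eqVneq (F t) fset0; first by rewrite cardfs0.
  case/allPn => x xD; rewrite -ltnNge => /ltnW/leq_trans-> //.
  by rewrite (big_rem x) //= leq_addr.
have h_gt0 : (0 < \sum_(g <- S) h g)%N.
  have g0S : g0 \in S by apply: contraNT hg0 => /hS ->.
  by rewrite (big_rem g0) //= addn_gt0 lt0n hg0.
(* Bound each level set by the sum of its defects, and exchange the sums. *)
have : ((size D).+1 * \sum_(g <- S) h g <= size D * \sum_(g <- S) h g)%N.
  rewrite -{1}sumF; apply: (@leq_trans ((size D).+1 * \sum_(t < M)
    \sum_(x <- D) n * #|` (F t `\` ltranslate x (F t))%fset|)).
    by rewrite leq_mul2l; apply/orP; right; apply: leq_sum.
  rewrite exchange_big big_distrr -[X in (_ <= X * _)%N]sum1_size big_distrl /=.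
  rewrite [leqLHS]big_seq [leqRHS]big_seq; apply: leq_sum => x xD; rewrite mul1n.
 rewrite -big_distrr sumFx mulnA [(_.+1 * n)%N]mulnC. exact: hD.
by rewrite leq_mul2r ltnn orbF eqn0Ngt h_gt0.
Qed.

(** The pushed function need not have integer values, so that
[level_set_Folner] is applied to a multiple of it. *)
Lemma Reiter_Folner (f : nat -> rat) N n (D : {fset nat}) : (0 < n)%N ->
  (forall i, 0 <= f i) -> (forall i, (N <= i)%N -> f i = 0) ->
  (exists i, f i != 0) ->
  (forall x, x \in D -> l1norm (push nu f \- ftranslate (nu x) (push nu f)) /
     l1norm (push nu f) < (n * #|` D|.+1)%:R^-1) ->
  exists2 F : {fset nat}, {subset F <= iota 0 N} &
    Folner n (image_fset nu D) (image_fset nu F).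
Proof.
move=> n_gt0 f_ge0 fN [i0 fi0] fD.
pose h := push nu f; pose S := undup [seq nu i | i <- iota 0 N].
have hE g : h g = \sum_(i <- iota 0 N) if nu i == g then f i else 0.
  apply: pushE => [|i]; first exact: iota_uniq.
  by rewrite mem_iota -leqNgt; exact: fN.
have h_ge0 g : 0 <= h g by rewrite hE; apply: sumr_ge0 => i _; case: ifP.
have S_uniq : uniq S by exact: undup_uniq.
have hS g : g \notin S -> h g = 0.
  rewrite mem_undup hE => gS; rewrite big_seq big1 // => i iN.
  by case: eqP => // gE; rewrite -gE map_f in gS.
have i0N : i0 \in iota 0 N.
  by rewrite mem_iota ltnNge; apply: contra fi0 => /fN ->.
have h_gt0 : 0 < h (nu i0).
  rewrite hE (big_rem i0) //= eqxx ltr_pwDl ?lt0r ?fi0 ?f_ge0 //.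
  by apply: sumr_ge0 => i _; case: ifP.
have i0S : nu i0 \in S by rewrite mem_undup map_f.
have normh : l1norm h = \sum_(g <- S) h g.
  by rewrite (l1normE S_uniq) //; apply: eq_bigr => g _; rewrite ger0_norm.
have normh_gt0 : 0 < l1norm h.
  by rewrite normh (big_rem (nu i0)) //= ltr_pwDl // sumr_ge0.
have normB x : \sum_(g <- S) `|h g - h (x^-1 * g)%g| <= l1norm (h \- ftranslate x h).
  pose T := S ++ [seq g <- undup [seq (x * g)%g | g <- S] | g \notin S].
  rewrite (@l1normE _ _ T).
  - by rewrite big_cat lerDl sumr_ge0.
  - rewrite cat_uniq S_uniq filter_uniq ?undup_uniq // andbT /=.
    by apply/hasPn => g; rewrite mem_filter => /andP[].
  move=> g; rewrite mem_cat negb_or => /andP[gS].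
  rewrite mem_filter gS mem_undup => gxS.
  rewrite /= /ftranslate (hS g gS) (hS (x^-1 * g)%g) ?subr0 //.
  apply: contra gxS => gS'.
  by apply/mapP; exists (x^-1 * g)%g; rewrite ?mulVKg.
(* [H] is the integer-valued function [q * h]. *)
have [|q q_gt0 qS] := @common_denominator [seq h g | g <- S].
  by move=> _ /mapP[g _ ->].
have /choice[H HE] g : exists m : nat, q%:R * h g = m%:R.
  have [gS|/hS ->] := boolP (g \in S); first by apply: qS; exact: map_f.
  by exists 0%N; rewrite mulr0.
have H0 g : (H g == 0%N) = (h g == 0).
  by rewrite -(eqr_nat rat) -HE mulf_eq0 pnatr_eq0 -[q == 0%N]negbK -lt0n q_gt0.
(* Only the positive parts of the differences at points of [S] are needed. *)
have [|||F [F0 FS] FD] := @level_set_Folner S H [seq nu x | x <- D] n S_uniq.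
- by move=> g /hS/eqP; rewrite -H0 => /eqP.
- by exists (nu i0); rewrite H0 gt_eqF.
- move=> _ /mapP[x xD ->]; rewrite size_map.
  have := fD x xD; rewrite ltr_pdivrMr // -/h.
  rewrite ltr_pdivlMl ?ltr0n ?muln_gt0 ?n_gt0 // => /ltW lex.
  rewrite -(ler_nat rat) natrM !natr_sum.
  rewrite (eq_bigr _ (fun g _ => esym (HE g))) -big_distrr /= -normh.
  apply: le_trans (ler_wpM2l (ler0n _ q) lex).
  rewrite mulrCA ler_wpM2l ?ler0n //.
  apply: le_trans (ler_wpM2l (ler0n _ q) (normB (nu x))).
  rewrite big_distrr; apply: ler_sum => g _ /=.
  rewrite -{1}[q%:R]ger0_norm ?ler0n // -normrM mulrBr !HE.
  have [le_H|/ltnW le_H] := leqP (H ((nu x)^-1 * g)%g) (H g).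
    by rewrite natrB // ler_norm.
  by move: le_H; rewrite -subn_eq0 => /eqP ->; exact: normr_ge0.
pose F' := [fset i in iota 0 N | nu i \in F]%fset.
exists F'; first by move=> i; rewrite !inE /= => /andP[].
have -> : image_fset nu F' = F.
  apply/fsetP => g; apply/imfsetP/idP => [[i + ->]|gF] /=.
    by rewrite !inE /= => /andP[].
  have /FS := gF; rewrite mem_undup => /mapP[i iN gE].
  by exists i; rewrite // !inE /= iN -gE.
apply/FolnerP => //; split=> // y /imfsetP[x /= xD ->].
by apply: FD; exact: map_f.
Qed.

End LevelSets.

(** * The search for Reiter functions *)

Local Open Scope nat_scope.

Section Numbered.
Variables (G : groupType) (nu : nat -> G).

(** The triples [(e0 m, e1 m, e2 m)] are exactly those of the multiplication
table. *)
Definition enumerates (e0 e1 e2 : nat -> nat) : Prop :=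
  forall i j k, (nu i * nu j)%g = nu k <->
    exists m, [/\ e0 m = i, e1 m = j & e2 m = k].

Lemma ce_group_enumeration : numbering nu -> ce_group nu ->
  exists e0 e1 e2, enumerates e0 e1 e2 /\
    [/\ effective e0, effective e1 & effective e2].
Proof.
move=> nu_surj [M0|[e ce ME]].
  have [k kE] := nu_surj (nu 0 * nu 0)%g.
  have : MultT nu [tuple 0; 0; k] by rewrite /MultT /= !(tnth_nth 0).
  by rewrite M0.
have ceff i : effective (fun m => e i [tuple m]).
  by apply: effective_tuple1 => //; exact: effective_id.
exists (fun m => e 0%R [tuple m]), (fun m => e 1%R [tuple m]),
  (fun m => e 2%R [tuple m]).
split=> // i j k.
have -> : (nu i * nu j)%g = nu k <-> MultT nu [tuple i; j; k].
  by rewrite /MultT /= !(tnth_nth 0).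
rewrite ME /=; split=> [[m _ mE]|[m [<- <- <-]]]; exists m => //.
  have E i' : e i' [tuple m] = tnth [tuple i; j; k] i'.
    by rewrite -mE tnth_mktuple.
  by split; rewrite E (tnth_nth 0).
apply: eq_from_tnth => i'; rewrite tnth_mktuple (tnth_nth 0).
case: i' => [[|[|[|]]] //= lt_i]; congr (e _ _); exact: val_inj.
Qed.

Section Enumerated.
Variables e0 e1 e2 : nat -> nat.
Hypothesis eP : enumerates e0 e1 e2.
Hypotheses (ce0 : effective e0) (ce1 : effective e1) (ce2 : effective e2).

(** The numbers in [ms] point to enumerated equations [nu x * nu i = nu j] that
match more than a proportion [1 - 1 / (2 n)] of [L] injectively into [L]. *)
Definition matching (x n : nat) (L ms : seq nat) : bool :=
  [&& all (fun m => (e0 m == x) && ((e1 m \in L) && (e2 m \in L))) ms,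
      uniq [seq e1 m | m <- ms], uniq [seq e2 m | m <- ms] &
      2 * n * (size L - size ms) < size L].

(** A certificate that the indicator of [c.1] is a Reiter function for [a.1] and
the finite set of canonical index [a.2]; [c.2] contains a matching for each
element of the set. Anything is a certificate if [a.1] is zero, which makes the
search for a certificate total. *)
Definition certificate (a : nat * nat) (c : seq nat * seq (seq nat)) : bool :=
  (a.1 == 0) || [&& 0 < size c.1, uniq c.1 & all (fun x => bit a.2 x ==>
    has (fun ms => matching x a.1 c.1 ms) c.2) (iota 0 a.2)].

Lemma effective_certificate : effective (fun p => certificate p.1 p.2).
Proof. rewrite /certificate /matching; eff. Qed.

(** A Folner set [F] for [2 n + 1] gives a certificate: take a number for each
element of [F], and match [g] with [nu x * g] whenever both are in [F]. *)
Lemma certificate_exists : numbering nu -> amenable G ->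
  forall a, exists c, certificate a c.
Proof.
move=> nu_surj amG [n d]; rewrite /certificate /=.
case: n => [|n0]; first by exists ([::], [::]).
set n := n0.+1; have n_gt0 : 0 < n by [].
have /choice[s sE] := nu_surj.
pose D := [fset i in iota 0 d | bit d i]%fset.
have [F /FolnerP[//|F0 FD]] := amG (2 * n).+1 (image_fset nu D) isT.
pose L : seq nat := [seq s g | g <- F].
have s_inj : injective s by exact: can_inj sE.
have xP x g : exists m, [/\ e0 m = x, e1 m = s g & e2 m = s (nu x * g)%g].
  by apply/eP; rewrite !sE.
have /choice[mt mtE] (p : nat * G) := xP p.1 p.2.
pose ms x : seq nat := [seq mt (x, g) | g <- F & (nu x * g)%g \in F].
exists (L, [seq ms x | x <- iota 0 d]) => /=.
apply/and3P; split.
- by rewrite size_map cardfs_gt0.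
- by rewrite map_inj_uniq ?fset_uniq.
apply/allP => x xd; apply/implyP => dx; apply/hasP; exists (ms x).
  exact: map_f.
have e1E : [seq e1 m | m <- ms x] = [seq s g | g <- F & (nu x * g)%g \in F].
  by rewrite -map_comp; apply: eq_map => g /=; have [] := mtE (x, g).
have e2E : [seq e2 m | m <- ms x] =
    [seq s (nu x * g)%g | g <- F & (nu x * g)%g \in F].
  by rewrite -map_comp; apply: eq_map => g /=; have [] := mtE (x, g).
rewrite /matching e1E e2E; apply/and4P; split.
- apply/allP => _ /mapP[g + ->]; rewrite mem_filter => /andP[xgF gF].
  by have [-> -> ->] := mtE (x, g); rewrite eqxx !map_f.
- by rewrite map_inj_uniq // filter_uniq ?fset_uniq.
- rewrite (map_inj_uniq (f := fun g => s (nu x * g)%g)) => [|g g'].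
    by rewrite filter_uniq ?fset_uniq.
  by move=> /s_inj/mulgI.
(* A defect of at most [u / (2 n + 1)] is less than [u / (2 n)]. *)
have aux u w : 0 < u -> (2 * n).+1 * w <= u -> 2 * n * w < u.
  rewrite mulSn; case: w => [|w] u_gt0; first by rewrite !muln0.
  by apply: leq_trans; rewrite addSn ltnS leq_addl.
have := FD (nu x); rewrite !size_map => /(_ _)/wrap[].
  by apply/imfsetP; exists x; rewrite // !inE /= xd.
have -> : #|` (F `\` ltranslate (nu x) F)%fset| =
    size F - size [seq g <- F | (nu x * g)%g \in F].
  have xI : injective (fun g => (nu x * g)%g) by exact: mulgI.
  have -> : size [seq g <- F | (nu x * g)%g \in F] =
      #|` (F `&` ltranslate (nu x) F)%fset|.
    rewrite -(size_map (fun g => (nu x * g)%g)); apply: perm_size.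
    apply: uniq_perm; rewrite ?fset_uniq ?map_inj_uniq ?filter_uniq ?fset_uniq //.
    move=> g.
    rewrite inE mem_ltranslate; apply/mapP/andP => [[h + ->]|[gF xgF]].
      by rewrite mem_filter mulKg => /andP[].
    by exists ((nu x)^-1 * g)%g; rewrite ?mem_filter ?mulVKg ?gF.
  by rewrite cardfsD.
apply: aux; first by rewrite cardfs_gt0.
Qed.

Lemma certificate_sound n (D : {fset nat}) c : 0 < n ->
  certificate (n, canonical_index D) c -> forall x, x \in D ->
  (l1norm (push nu (indicator c.1) \- ftranslate (nu x) (push nu (indicator c.1)))
   / l1norm (push nu (indicator c.1)) < n%:R^-1)%R.
Proof.
case: c => L W n_gt0; rewrite /certificate /= eqn0Ngt n_gt0 /=.
case/and3P => _ L_uniq /allP DW x xD.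
have dx : bit (canonical_index D) x by rewrite bit_canonical_index.
have := DW x; rewrite mem_iota /= (bit_lt dx) dx => /(_ isT) /= /hasP[ms _].
case/and4P => /allP msP ms1 ms2 ltL.
pose P := [seq (e1 m, e2 m) | m <- ms].
have P1 : unzip1 P = [seq e1 m | m <- ms] by rewrite /unzip1 -map_comp.
have P2 : unzip2 P = [seq e2 m | m <- ms] by rewrite /unzip2 -map_comp.
apply: (@almost_invariant_indicator _ _ _ _ P); rewrite ?P1 ?P2 ?size_map //.
- by move=> _ /mapP[m /msP + ->] => /and3P[].
- by move=> _ /mapP[m /msP + ->] => /and3P[].
move=> _ _ /mapP[m /msP + [-> ->]] => /and3P[/eqP <- _ _].
by apply/eP; exists m.
Qed.

(** The code, as read by [weights], of the indicator of [L]: the numerators are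
at the even positions, and the odd positions contain predecessors of
denominators. The elements of [L] are smaller than its code. *)
Definition indicator_code (L : seq nat) : nat :=
  enc (mkseq (fun k => nat_of_bool (~~ odd k && (k./2 \in L))) (enc L).*2).

Lemma weights_indicator_code L : weights (indicator_code L) = indicator L.
Proof.
apply/funext => i; rewrite /weights /indicator_code /= CodeSeq.codeK map_id map_id.
set N := CodeSeq.code L.
have LN j : j \in L -> j < N by move: j; apply/allP; exact: CodeSeq.ltn_code.
have [lt_iN|le_Ni] := ltnP i N.
  rewrite !nth_mkseq ?ltn_double ?ltn_Sdouble //=.
  by rewrite negbK odd_double doubleK /= divr1.
rewrite !nth_default ?size_mkseq ?leq_double ?leqW ?leq_double // mul0r /indicator.
by case: (boolP (i \in L)) => // /LN; rewrite ltnNge le_Ni.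
Qed.

Lemma amenable_Reiter : numbering nu -> amenable G -> computable_Reiter nu.
Proof.
move=> nu_surj amG.
have [||f cf fP] := effective_search _ _ effective_certificate
  (certificate_exists nu_surj amG).
- exact: prod_enc_surjective nat_enc_surjective nat_enc_surjective.
- apply: prod_enc_surjective; do ?apply: seq_enc_surjective;
    exact: nat_enc_surjective.
exists (fun t => indicator_code (f (tnth t 0%R, tnth t 1%R)).1).
  apply: (computable_effective2 (f := fun p => indicator_code (f p).1)).
  apply: (effective_comp (g := indicator_code)); last by eff.
  apply: (@eq_effective _ _ (fun L : seq nat => enc (mkseq
    (fun k => if ~~ odd k && (k./2 \in L) then 1 else 0) (enc L + enc L)))).
    by move=> L; rewrite addnn.
  by apply/effective_enc/effective_mkseq; [apply: effective_if|]; eff.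
move=> n D n_gt0 /=.
rewrite weights_indicator_code !(tnth_nth 0) /=.
have cP := fP (n, canonical_index D); split; last exact: certificate_sound cP.
move: cP; rewrite /certificate /= eqn0Ngt n_gt0 /= => /andP[+ _].
case: (f _).1 => // i L _; exists i.
by rewrite /indicator mem_head.
Qed.

End Enumerated.

(** * Consequences of computable Reiter functions *)

Lemma leq_size_decode c : size (CodeSeq.decode c) <= c.
Proof.
rewrite -[leqRHS]CodeSeq.decodeK -[X in CodeSeq.code X]map_id.
exact: (@leq_size_enc nat_encType).
Qed.

(** The canonical index of [D] is at least the cardinal of [D], so that it can
be used in the constant with which the Reiter functions are called. *)
Lemma Reiter_Folner_subset r n (D : {fset nat}) : 0 < n ->
  (forall n (D : {fset nat}), 0 < n ->
     let f := weights (r [tuple n; canonical_index D]) in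
     (exists i, f i != 0%R) /\
     forall x, x \in D ->
       (l1norm (push nu f \- ftranslate (nu x) (push nu f)) / l1norm (push nu f)
         < n%:R^-1)%R) ->
  let c := r [tuple n * (canonical_index D).+1; canonical_index D] in
  exists2 F : {fset nat}, {subset F <= iota 0 c} &
    Folner n (image_fset nu D) (image_fset nu F).
Proof.
move=> n_gt0 rP c.
have [//|f0 fD] := rP (n * (canonical_index D).+1) D; first by rewrite muln_gt0 n_gt0.
apply: (@Reiter_Folner _ _ (weights c)) => // [i|i le_ci|x xD].
- exact: weights_ge0.
- rewrite /weights nth_default ?mul0r //.
  by rewrite -addnn (leq_trans (leq_size_decode c)) ?(leq_trans le_ci) ?leq_addr.
apply: lt_le_trans (fD x xD) _; rewrite lef_pV2 ?posrE ?ltr0n ?muln_gt0 ?n_gt0 //.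
by rewrite ler_nat leq_pmul2l // ltnS card_leq_canonical_index.
Qed.

Lemma image_fset_surj : numbering nu -> forall D, exists D', image_fset nu D' = D.
Proof.
move=> /choice[s sE] D; exists [fset s g | g in D]%fset.
apply/fsetP => g; apply/imfsetP/idP => [[_ /imfsetP[h /= hD ->] ->]|gD].
  by rewrite sE.
by exists (s g); rewrite ?sE //= in_imfset.
Qed.

Lemma Folner_function_le n (D : {fset G}) (F : {fset G}) m :
  Folner n D F -> #|` F| <= m -> (Folner_function n D <= m%:Z%:E)%E.
Proof.
move=> FD le_m; rewrite /Folner_function; case: pselect => [ex|[]].
  rewrite lee_fin lez_nat; case: ex_minnP => k _ min_k.
  by apply: leq_trans le_m; apply: min_k; apply/asboolP; exists F.
by exists #|` F|; apply/asboolP; exists F.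
Qed.

Lemma Reiter_subrecursive : computable_Reiter nu -> subrecursive_Folner nu.
Proof.
move=> [r cr rP].
exists (fun t => r [tuple tnth t 0%R * (tnth t 1%R).+1; tnth t 1%R]).
  apply: (computable_effective2 (f := fun p => r [tuple p.1 * p.2.+1; p.2])).
  by apply: effective_tuple2 => //; eff.
move=> n D n_gt0; rewrite !(tnth_nth 0) /=.
have [F Fc FD] := Reiter_Folner_subset D n_gt0 rP.
apply: Folner_function_le FD _; apply: (@leq_trans #|` F|).
  exact: leq_imfset_card.
rewrite -[leqRHS](size_iota 0); apply: uniq_leq_size => //; exact: fset_uniq.
Qed.

Lemma subrecursive_amenable : numbering nu -> subrecursive_Folner nu -> amenable G.
Proof.
move=> nu_surj [u _ uP] n D n_gt0.
have [D' D'E] := image_fset_surj nu_surj D.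
have := uP n D' n_gt0; rewrite D'E /Folner_function.
by case: pselect => // -[m /asboolP[F FD _]] _; exists F.
Qed.

Lemma Reiter_Sigma : computable_Reiter nu -> Sigma_amenable nu.
Proof.
move=> [r cr rP].
exists (fun t => 2 ^ r [tuple tnth t 0%R * (tnth t 1%R).+1; tnth t 1%R] - 1).
  apply: (computable_effective2 (f := fun p => 2 ^ r [tuple p.1 * p.2.+1; p.2] - 1)).
  apply: effective_sub; last by eff.
  by apply: effective_exp; [eff | apply: effective_tuple2 => //; eff].
move=> n D n_gt0; rewrite !(tnth_nth 0) /=.
have [F Fc FD] := Reiter_Folner_subset D n_gt0 rP.
set c := r _ in Fc *; exists [fset i in iota 0 c]%fset.
  by rewrite canonical_index_iota.
by exists F => //; apply/fsubsetP => i /Fc; rewrite !inE.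
Qed.

Lemma Sigma_amenable_amenable : numbering nu -> Sigma_amenable nu -> amenable G.
Proof.
move=> nu_surj [a _ aP] n D n_gt0.
have [D' D'E] := image_fset_surj nu_surj D.
have [_ _ [F _]] := aP n D' n_gt0; rewrite D'E => FD.
by exists (image_fset nu F).
Qed.

(** * The word problem in computably amenable groups *)

Section WordProblem.
Variables e0 e1 e2 : nat -> nat.
Hypothesis eP : enumerates e0 e1 e2.
Hypotheses (ce0 : effective e0) (ce1 : effective e1) (ce2 : effective e2).

Variable a : nat * nat -> nat.
Hypothesis ca : effective a.
Hypothesis aP : forall n (D : {fset nat}), 0 < n ->
  exists2 F : {fset nat}, a (n, canonical_index D) = canonical_index F &
    Folner n (image_fset nu D) (image_fset nu F) /\ #|` F| = #|` image_fset nu F|.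

(** For [t = (i, (j, k))], the numbers in [m] point to equations
[nu i * nu j = nu p], [nu q * nu k = nu p] and [nu q * nu f = nu f'], with [f]
and [f'] in the Folner set computed for [{q}]. *)
Definition witness (t : nat * (nat * nat)) (m : nat * (nat * nat)) : bool :=
  [&& e0 m.1 == t.1, e1 m.1 == t.2.1,
      e1 m.2.1 == t.2.2, e2 m.2.1 == e2 m.1,
      e0 m.2.2 == e0 m.2.1,
      bit (a (2, 2 ^ e0 m.2.1)) (e1 m.2.2) &
      bit (a (2, 2 ^ e0 m.2.1)) (e2 m.2.2)].

Lemma effective_witness : effective (fun p => witness p.1 p.2).
Proof. rewrite /witness; eff. Qed.

Lemma witness_exists : numbering nu -> forall t, exists m, witness t m.
Proof.
move=> nu_surj [i [j k]].
have [p pE] := nu_surj (nu i * nu j)%g.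
have [q qE] := nu_surj (nu p * (nu k)^-1)%g.
have [m1 [m1i m1j m1p]] : exists m, [/\ e0 m = i, e1 m = j & e2 m = p] by apply/eP.
have [m2 [m2q m2k m2p]] : exists m, [/\ e0 m = q, e1 m = k & e2 m = p].
  by apply/eP; rewrite qE mulgVK.
have [F aF [/FolnerP[//|F0 FD] _]] := @aP 2 [fset q]%fset isT.
have /fset0Pn[y] :
    (image_fset nu F `&` ltranslate (nu q) (image_fset nu F) != fset0)%fset.
  have := FD (nu q); rewrite cardfsD => /(_ _)/wrap[].
    by apply/imfsetP; exists q; rewrite //= inE.
  rewrite -!cardfs_gt0 in F0 *; case: #|` _| F0 => // u _.
  by case: #|` _ | => //; lia.
rewrite inE mem_ltranslate => /andP[/imfsetP[f' /= f'F yE] /imfsetP[f /= fF fE]].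
have [m3 [m3q m3f m3f']] : exists m, [/\ e0 m = q, e1 m = f & e2 m = f'].
  by apply/eP; rewrite -fE -yE mulVKg.
exists (m1, (m2, m3)); rewrite /witness /= m1i m1j m2k m2p m1p m3q m2q !eqxx /=.
by rewrite -canonical_index1 aF !bit_canonical_index m3f m3f' fF f'F.
Qed.

(** Both sides are equivalent to [nu q = 1], where [q] is as in [witness]. *)
Lemma witness_sound i j k m : witness (i, (j, k)) m ->
  (nu i * nu j)%g = nu k <-> e1 m.2.2 = e2 m.2.2.
Proof.
case: m => m1 [m2 m3]; rewrite /witness /= => /and5P[/eqP m1i /eqP m1j /eqP m2k].
move=> /eqP m2p /and3P[/eqP m3q].
have [F aF [_ F_inj]] := @aP 2 [fset e0 m2]%fset isT.
rewrite -canonical_index1 aF !bit_canonical_index => fF f'F.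
have nu_inj : {in F &, injective nu} by apply/card_in_imfsetP/eqP; rewrite F_inj.
have M1 : (nu i * nu j)%g = nu (e2 m1) by apply/eP; exists m1.
have M2 : (nu (e0 m2) * nu k)%g = nu (e2 m1) by apply/eP; exists m2.
have M3 : (nu (e0 m2) * nu (e1 m3))%g = nu (e2 m3) by apply/eP; exists m3.
rewrite M1 -M2; split=> [E|E].
  apply: nu_inj => //; rewrite -M3.
  suff -> : nu (e0 m2) = 1%g by rewrite mul1g.
  by apply: (mulIg (nu k)); rewrite E mul1g.
suff -> : nu (e0 m2) = 1%g by rewrite mul1g.
by apply: (mulIg (nu (e1 m3))); rewrite M3 mul1g E.
Qed.

Lemma computable_group_witness : numbering nu -> computable_group nu.
Proof.
move=> nu_surj.
have nat3 : enc_surjective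
    (prod_encType nat_encType (prod_encType nat_encType nat_encType)).
  by do 2?[apply: prod_enc_surjective]; exact: nat_enc_surjective.
have [w cw wP] := effective_search nat3 nat3 effective_witness
  (witness_exists nu_surj).
have cb : effective (fun t => e1 (w t).2.2 == e2 (w t).2.2) by eff.
apply: eq_computable (computable_effective3 cb) => t; congr nat_of_bool.
have := wP (tnth t 0%R, (tnth t 1%R, tnth t 2%R)) => /witness_sound wE.
by apply/eqP/asboolP => /wE.
Qed.

End WordProblem.
End Numbered.

Theorem theorem1 (G : groupType) (nu : nat -> G)
  (nu_surj : numbering nu) (nu_ce : ce_group nu) :
  [<-> amenable G;
       computable_Reiter nu;
       subrecursive_Folner nu;
       Sigma_amenable nu]
  /\ (computably_amenable nu -> computable_group nu).
Proof.
have [e0 [e1 [e2 [eP [ce0 ce1 ce2]]]]] := ce_group_enumeration nu_surj nu_ce.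
have am_Reiter := amenable_Reiter eP ce0 ce1 ce2 nu_surj.
split.
  tfae=> //; last exact: Sigma_amenable_amenable.
    exact: Reiter_subrecursive.
  by move=> /(subrecursive_amenable nu_surj)/am_Reiter/Reiter_Sigma.
move=> [a ca aP].
apply: (computable_group_witness eP ce0 ce1 ce2
  (a := fun p => a [tuple p.1; p.2]) _ aP nu_surj).
by apply: effective_tuple2 => //; eff.
Qed.
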